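(* Let $H$ be a finite-dimensional real inner-product space, $z_0\in H$, and let $Z$ be a smooth vector field and $F,\mathcal C_1,\ldots,\mathcal C_m$ smooth functionals defined near $z_0$. Let $Z(z_0)\ne0$, and suppose that $\mathrm dF(Z)=0$ and $\mathrm d\mathcal C_a(Z)=0$, $a=1,\ldots,m$, near $z_0$. If $\mathrm dF,\mathrm d\mathcal C_1,\ldots,\mathrm d\mathcal C_m$ are linearly independent at $z_0$, then locally (on a neighborhood of $z_0$) there is a vector field $Y$ with $$[Y,Z]=0,\qquad \mathrm dF(Y)=1,\qquad \mathrm d\mathcal C_a(Y)=0,\quad a=1,\ldots,m,$$ and $L_2=Y\wedge Z$ defines a Poisson structure with $$L_2\nabla F=Z,\qquad L_2\nabla\mathcal C_a=0,\quad a=1,\ldots,m.$$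
   Context: For a differentiable functional $Q$, $\nabla Q$ is its gradient with respect to $\langle\cdot,\cdot\rangle$. The decomposable bivector $Y\wedge Z$ is identified with the skew-symmetric map $(Y\wedge Z)v=\langle Y,v\rangle Z-\langle Z,v\rangle Y$, $v\in H$ (pointwise in the state). The Lie bracket of vector fields is $[X,Z]=DZ[X]-DX[Z]$. A (state-dependent) skew-symmetric map $L:H\to H$ induces the bracket $\{\mathcal A,\mathcal B\}_L=\langle\nabla\mathcal A,L\nabla\mathcal B\rangle$ on smooth functionals, and it defines a Poisson structure if for all smooth $\mathcal A,\mathcal B,\mathcal C$ $$\{\mathcal A,\{\mathcal B,\mathcal C\}_L\}_L+\{\mathcal B,\{\mathcal C,\mathcal A\}_L\}_L+\{\mathcal C,\{\mathcal A,\mathcal B\}_L\}_L=0.$$ *)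

(* Defs.v *)
From HB Require Import structures.
From mathcomp Require Import all_boot all_order all_algebra.
From mathcomp Require Import all_classical all_reals all_analysis.

Set Implicit Arguments.
Unset Strict Implicit.
Unset Printing Implicit Defensive.

Import Order.TTheory GRing.Theory Num.Theory.
Import numFieldNormedType.Exports.

Local Open Scope classical_set_scope.
Local Open Scope ring_scope.

(* Only linearity on the left is required: linearity on the right follows by
   symmetry, and positive definiteness follows from inner_norm. *)
HB.mixin Record NormedModule_hasInner (R : realType) H
    & NormedModule R H := {
  inner : H -> H -> R ;
  inner_sym : forall u v, inner u v = inner v u ;
  inner_linearl : forall a u v w,
    inner (a *: u + v) w = a * inner u w + inner v w ;
  inner_norm : forall u, inner u u = `|u| ^+ 2 }.

(* Finite-dimensional real inner-product spaces, with the induced norm. *)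
#[short(type="innerProductType")]
HB.structure Definition InnerProductSpace (R : realType) :=
  {H of Vector R H & NormedModule R H & NormedModule_hasInner R H}.

Section InnerProduct.
Context {R : realType} {H : innerProductType R}.
Implicit Types u v w g : H.

Lemma inner_linear u : linear_for *%R (inner u).
Proof. by move=> a v w; rewrite ![inner u _]inner_sym inner_linearl. Qed.

HB.instance Definition _ u :=
  GRing.isLinear.Build R H R^o *:%R (inner u) (inner_linear u).

Definition inner_lfun u : 'Hom(H, R^o) := linfun (inner u : H -> R^o).

Lemma inner_lfunE u v : inner_lfun u v = inner u v.
Proof. exact: lfunE. Qed.

Lemma inner_lfun_linear : linear inner_lfun.
Proof.
move=> a u v; apply/lfunP => w.
by rewrite add_lfunE scale_lfunE !inner_lfunE inner_linearl.
Qed.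

HB.instance Definition _ :=
  GRing.isLinear.Build R H 'Hom(H, R^o) *:%R inner_lfun inner_lfun_linear.

Lemma riesz (l : {linear H -> R^o}) : exists g, forall v, inner g v = l v.
Proof.
pose phi : 'Hom(H, 'Hom(H, R^o)) := linfun inner_lfun.
have kphi : lker phi == 0%VS.
  rewrite -subv0; apply/subvP => u; rewrite memv_ker memv0 lfunE /= => /eqP eu.
  have := inner_norm u; rewrite -inner_lfunE eu lfunE /= => /esym/eqP.
  by rewrite sqrf_eq0 normr_eq0.
have : linfun l \in limg phi.
  suff -> : limg phi = fullv by rewrite memvf.
  apply/eqP; rewrite -dimv_leqif_eq ?subvf// limg_dim_eq; last first.
    by rewrite (eqP kphi) capv0.
  by rewrite !dimvf /dim /= muln1.
case/memv_imgP => g _ /lfunP eg; exists g => v.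
have eg' : inner_lfun g = phi g by rewrite lfunE.
by rewrite -inner_lfunE eg' -eg lfunE.
Qed.

(* The Riesz representative of the differential of f at x; well defined by
   gradE and gradP below. *)
Definition grad (f : H -> R) (x : H) : H :=
  get [set g | forall v, inner g v = 'd f x v].

Lemma gradE (f : H -> R) (x v : H) : inner (grad f x) v = 'd f x v.
Proof.
rewrite /grad; case: (riesz ('d f x)) => g eg.
exact: (@getPex _ [set g | forall v, inner g v = 'd f x v] (ex_intro _ g eg)).
Qed.

Lemma gradP (f : H -> R) (x g : H) :
  (forall v, inner g v = 'd f x v) -> grad f x = g.
Proof.
move=> eg; apply/eqP; rewrite -subr_eq0 -normr_eq0 -sqrf_eq0 -inner_norm.
have d0 w : inner (grad f x - g) w = 0; last by rewrite d0.
by rewrite addrC -scaleN1r inner_linearl eg gradE mulN1r addNr.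
Qed.

Definition wedge (Y Z : H) : H -> H :=
  fun v => inner Y v *: Z - inner Z v *: Y.

Definition skew_symmetric_map (L : H -> H) : Prop :=
  linear L /\ forall u v, inner u (L v) = - inner (L u) v.

Definition poisson_bracket (L : H -> H -> H) (A B : H -> R) : H -> R :=
  fun z => inner (grad A z) (L z (grad B z)).

End InnerProduct.

Section Smooth.
Context {R : realType} {V W : normedModType R}.

(* C^k on an open set U, for a function that is total but only relevant on U.
   On a finite-dimensional V, requiring every directional derivative to be
   C^k is the same as requiring the differential to be C^k. *)
Fixpoint is_Ck (k : nat) (U : set V) (f : V -> W) : Prop :=
  if k is k'.+1 then
    (forall x, U x -> differentiable f x) /\ (forall v, is_Ck k' U ('D_v f))
  else forall x, U x -> {for x, continuous f}.

Definition smooth_on (U : set V) (f : V -> W) : Prop := forall k, is_Ck k U f.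

End Smooth.

Section VectorFields.
Context {R : realType} {H : innerProductType R}.

Definition lie_bracket (X Z : H -> H) : H -> H :=
  fun z => 'd Z z (X z) - 'd X z (Z z).

(* The functionals range over those smooth on W, not only over restrictions
   to W of functionals smooth on all of H. *)
Definition poisson_on (W : set H) (L : H -> H -> H) : Prop :=
  (forall z, W z -> skew_symmetric_map (L z)) /\
  (forall A B C : H -> R, smooth_on W A -> smooth_on W B -> smooth_on W C ->
   forall z, W z ->
     poisson_bracket L A (poisson_bracket L B C) z
   + poisson_bracket L B (poisson_bracket L C A) z
   + poisson_bracket L C (poisson_bracket L A B) z = 0).

End VectorFields.

(* Main.v *)
From HB Require Import structures.
Require Import Defs.
From mathcomp Require Import all_boot all_order all_algebra.
From mathcomp Require Import all_classical all_reals all_analysis.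
From mathcomp Require Import perm measurable_realfun ring lra.

Set Implicit Arguments.
Unset Strict Implicit.
Unset Printing Implicit Defensive.

Import Order.TTheory GRing.Theory Num.Theory.
Import numFieldNormedType.Exports.

Local Open Scope classical_set_scope.
Local Open Scope ring_scope.

(** The field [Y] is obtained by transporting a field along the flow of [Z].

    Let [phi t] be the local flow of [Z] near [z0] and [psi t x v] the
    derivative of [phi t] at [x] in the direction [v]. Two auxiliary objects are
    needed. A smooth function [s] with [s z0 = 0] and derivative 1 along [Z]
    measures the time elapsed on each orbit ([time_function]). A smooth field
    [Y0] has the required values, that is dF(Y0) = 1 and dC_a(Y0) = 0; it is a
    combination of the gradients at [z0], whose Gram matrix is invertible, with
    coefficients given by Cramer's rule ([dual_field]). Going back along the
    orbit of [z] for the time [s z] leads to [q z = phi (- s z) z], and [Y] is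
    the push-forward of [Y0] from there:
      [Y z = psi (s z) (q z) (Y0 (q z))].
    Along an orbit [q] is constant and [s] grows at unit speed, so [Y] satisfies
    the variational equation of the flow, which is the equation [Y, Z] = 0. The
    functionals F and C_a are constant on orbits, hence [phi t] pulls their
    differentials back to themselves and Y has at [z] the values that [Y0] has
    at [q z] ([symmetry_field]).

    For L = Y /\ Z the bracket is {A, B} = dB(Y) dA(Z) - dB(Z) dA(Y). The
    second derivatives of a functional are symmetric ([schwarz]), so [Y, Z] = 0
    says that the derivations along Y and along Z commute, and then the second
    order terms of the Jacobi sum cancel in pairs ([poisson_on_wedge]). The
    values of L on the gradients can be read off from dF(Y), dF(Z), dC_a(Y) and
    dC_a(Z).

    The time function is itself read off a flow. With h = <Z z0, Z>, the field
    Z/h raises the linear function <Z z0, . - z0> at unit speed, so the time at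
    which it reaches the hyperplane through [z0] is explicit, and a second
    component records the time that Z itself needs.

    What remains is the existence of smooth local flows ([local_flow_exists]).
    Solutions come from Picard iteration ([ode_exists]) and are compared by a
    Gronwall inequality ([gronwall]). For the smoothness, the flow of Z together
    with its derivative is the flow of the tangent field (x, v) |-> (Z x, dZ x v)
    on V * V. If the flow of every smooth field is C^k, then so is this
    derivative, and the flow of Z is C^(k+1) ([flow_Ck]). For this induction the
    theory is developed on all normed spaces with finitely many continuous
    coordinates ([frame]), a class closed under products. *)

(** * Directional derivatives, frames and mean value inequalities *)

Section DerivativeTools.
Context {R : realType}.
Implicit Types V W X : normedModType R.

(** The form in which all derivatives are computed below: the increment is
    never divided, so no step has to be nonzero. *)
Lemma is_deriveP V W (f : V -> W) (x v : V) (d : W) :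
  is_derive x v f d <->
  forall e : R, 0 < e -> exists2 r : R, 0 < r &
    forall h : R, `|h| < r -> `|f (x + h *: v) - f x - h *: d| <= e * `|h|.
Proof.
split.
- move=> [df dE] e e0.
  have : (fun h : R => h^-1 *: ((f \o shift x) (h *: v) - f x)) @ 0^' --> d.
    by rewrite -dE.
  move=> /cvgrPdist_le /(_ _ e0) /nbhs_ballP [r /= r0 H].
  exists r => // h hr.
  have [->|h0] := eqVneq h 0.
    by rewrite !scale0r addr0 subrr subr0 !normr0 mulr0.
  have /= := H h; rewrite -ball_normE /= sub0r normrN => /(_ hr h0).
  rewrite -[leRHS]mulr1 => Hle.
  have -> : f (x + h *: v) - f x - h *: d =
     - (h *: (d - h^-1 *: (f (h *: v + x) - f x))).
    rewrite [x + _]addrC; set D := f _ - f x.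
    by rewrite scalerBr scalerKV// opprB.
  by rewrite normrN normrZ mulrC ler_wpM2r//; rewrite mulr1 in Hle.
- move=> H.
  suff cv : (fun h : R => h^-1 *: ((f \o shift x) (h *: v) - f x)) @ 0^' --> d.
    split; first by apply/cvg_ex; exists d.
    by apply: cvg_lim cv.
  apply/cvgrPdist_le => e e0; have [r r0 Hr] := H e e0.
  apply/nbhs_ballP; exists r => //= h; rewrite -ball_normE /= sub0r normrN => hr h0.
  have -> : d - h^-1 *: (f (h *: v + x) - f x) =
     - (h^-1 *: (f (x + h *: v) - f x - h *: d)).
    rewrite [x + _]addrC; set D := f _ - f x.
    by rewrite [in RHS]scalerBr scalerK// opprB.
  rewrite normrN normrZ normfV ler_pdivrMl ?normr_gt0// mulrC.
  exact: Hr.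
Qed.

Lemma is_derive_lin V W X (l : {linear W -> X}) (f : V -> W) (x v : V) (d : W) :
  continuous l -> is_derive x v f d -> is_derive x v (l \o f) (l d).
Proof.
move=> cl /is_deriveP H; apply/is_deriveP => e e0.
have [k k0 lk] := linear_lipschitz cl.
have [r r0 Hr] := H (e / k) (divr_gt0 e0 k0).
exists r => // h hr; rewrite /= -linearB -linearZ -linearB.
apply: le_trans (lk _) _; rewrite mulrC -ler_pdivlMr// mulrAC.
exact: Hr.
Qed.

End DerivativeTools.

(** The form of finite dimension used throughout. It passes to products, which
    the tangent fields require, and it reduces estimates and limits to finitely
    many real-valued coordinates. *)
Record frame (R : realType) (V : normedModType R) := Frame {
  fr_n : nat;
  fr_v : 'I_fr_n -> V;
  fr_c : 'I_fr_n -> {linear V -> R};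
  fr_cont : forall i, continuous (fr_c i);
  frE : forall x, x = \sum_i fr_c i x *: fr_v i }.

Arguments fr_v {R V} f i : rename.
Arguments fr_c {R V} f i : rename.
Arguments fr_cont {R V} f i : rename.
Arguments frE {R V} f x : rename.

Section Frame.
Context {R : realType} {V : normedModType R} (b : frame V).

Definition fr_lip i : R := sval (cid2 (linear_lipschitz (fr_cont b i))).

Lemma fr_lip_gt0 i : 0 < fr_lip i.
Proof. by rewrite /fr_lip; case: cid2. Qed.

Lemma fr_lipP i x : `|fr_c b i x| <= fr_lip i * `|x|.
Proof. by rewrite /fr_lip; case: cid2 => k /= k0; apply. Qed.

(** Price of estimating a vector by its coordinates: it enters every
    inequality that is proved coordinatewise. The summand 1 makes it positive
    on the zero space as well. *)
Definition kappa : R := 1 + \sum_i fr_lip i * `|fr_v b i|.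

Lemma kappa_gt0 : 0 < kappa.
Proof.
rewrite /kappa ltr_wpDr//; apply: sumr_ge0 => i _.
by rewrite mulr_ge0// ltW// fr_lip_gt0.
Qed.

Lemma fr_norm_le x (M : R) : 0 <= M ->
  (forall i, `|fr_c b i x| <= fr_lip i * M) -> `|x| <= kappa * M.
Proof.
move=> M0 H; rewrite {1}(frE b x) /kappa mulrDl mul1r.
apply: (@le_trans _ _ (\sum_i fr_lip i * `|fr_v b i| * M)); last first.
  by rewrite -mulr_suml lerDr.
apply: le_trans (ler_norm_sum _ _ _) _; apply: ler_sum => i _.
by rewrite normrZ mulrAC ler_wpM2r.
Qed.

End Frame.

Arguments fr_lip {R V} b i.
Arguments fr_lip_gt0 {R V} b i.
Arguments fr_lipP {R V} b i x.


Section MeanValue.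
Context {R : realType}.

Lemma mean_value_majorant_real (h h' G g : R -> R) (a b : R) : a <= b ->
  (forall s, a <= s <= b -> is_derive s 1 h (h' s)) ->
  (forall s, a <= s <= b -> is_derive s 1 G (g s)) ->
  (forall s, a <= s <= b -> h' s <= g s) ->
  h b - h a <= G b - G a.
Proof.
move=> ab dh dG hg.
have dk s : s \in `[a, b] -> is_derive s 1 (G - h) (g s - h' s).
  rewrite in_itv /= => sab; have := dh s sab; have := dG s sab => ? ?.
  exact: is_deriveB.
have ooW s : s \in `]a, b[ -> s \in `[a, b] by move/subset_itv_oo_cc.
suff : (G - h) a <= (G - h) b by rewrite -![(_ - _) _]/(_ - _); lra.
apply: (@ger0_derive1_le_cc R (G - h) a b) => //.
- by move=> s /ooW /dk [].
- move=> s /ooW sab; have [_ E] := dk s sab; rewrite derive1E E subr_ge0.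
  by apply: hg; rewrite in_itv in sab.
- by apply: derivable_within_continuous => s /dk [].
- by rewrite in_itv /= lexx.
- by rewrite in_itv /= lexx andbT.
Qed.

(** Each coordinate of [h], up to a constant, grows more slowly than the
    majorant [G]; [kappa] collects the constants. *)
Lemma mean_value_majorant (V : normedModType R) (fV : frame V)
    (h h' : R -> V) (G g : R -> R) (a b : R) : a <= b ->
  (forall s, a <= s <= b -> is_derive s 1 h (h' s)) ->
  (forall s, a <= s <= b -> is_derive s 1 G (g s)) ->
  (forall s, a <= s <= b -> `|h' s| <= g s) ->
  `|h b - h a| <= kappa fV * (G b - G a).
Proof.
move=> ab dh dG hg.
have g0 s : a <= s <= b -> 0 <= g s by move=> /hg; apply: le_trans.
have G0 : 0 <= G b - G a.
  have := @mean_value_majorant_real (cst 0) (cst 0) G g a b ab.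
  rewrite subrr; apply => // s; exact: is_derive_cst.
apply: fr_norm_le => // i; rewrite linearB /=.
set k := fr_lip fV i; have k0 : 0 < k := fr_lip_gt0 fV i.
have dkG s : a <= s <= b -> is_derive s 1 (k \*: G) (k *: g s).
  by move=> /dG ?; apply: is_deriveZ.
have dc s : a <= s <= b -> is_derive s 1 (fr_c fV i \o h) (fr_c fV i (h' s)).
  by move=> /dh; apply: is_derive_lin; exact: fr_cont.
have cb s : a <= s <= b -> `|fr_c fV i (h' s)| <= k * g s.
  by move=> sab; apply: le_trans (fr_lipP _ _ _) _; rewrite ler_pM2l// hg.
have := @mean_value_majorant_real _ _ _ _ a b ab dc dkG.
have dcN s : a <= s <= b ->
    is_derive s 1 (- (fr_c fV i \o h)) (- fr_c fV i (h' s)).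
  by move=> /dc ?; apply: is_deriveN.
have := @mean_value_majorant_real _ _ _ _ a b ab dcN dkG.
have cbN s : a <= s <= b -> - fr_c fV i (h' s) <= k *: g s.
  by move/cb; rewrite ler_norml lerNl => /andP[].
have cbP s : a <= s <= b -> fr_c fV i (h' s) <= k *: g s.
  by move/cb; rewrite ler_norml => /andP[].
move=> /(_ cbN) + /(_ cbP).
rewrite -![(- _) _]/(- _) /= -![k *: _]/(k * _) ler_norml => H1 H2.
by apply/andP; split; lra.
Qed.

End MeanValue.

Section MoreDerivativeTools.
Context {R : realType}.
Implicit Types V W X : normedModType R.

Lemma is_deriveZv V W (f : V -> W) (x v : V) (d : W) (c : R) :
  is_derive x v f d -> is_derive x (c *: v) f (c *: d).
Proof.
move=> /is_deriveP H; apply/is_deriveP => e e0.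
have c1 : 0 < `|c| + 1 by rewrite ltr_wpDl.
have [r r0 Hr] := H (e / (`|c| + 1)) (divr_gt0 e0 c1).
exists (r / (`|c| + 1)); first exact: divr_gt0.
move=> h; rewrite ltr_pdivlMr// => hr.
have := Hr (h * c).
rewrite !scalerA => H'; apply: le_trans (H' _) _.
  rewrite normrM; apply: le_lt_trans hr; rewrite ler_wpM2l//; lra.
rewrite normrM mulrAC ler_pdivrMr// -mulrA ler_wpM2l//; first exact: ltW.
rewrite ler_wpM2l//; lra.
Qed.

Lemma is_derive_line V W (f : V -> W) (x v : V) (d : W) (s : R) :
  is_derive (x + s *: v) v f d <-> is_derive s 1 (fun s => f (x + s *: v)) d.
Proof.
split=> /is_deriveP H; apply/is_deriveP => e e0; have [r r0 Hr] := H e e0;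
  exists r => // h hr; have := Hr h hr;
  by rewrite -[h *: 1]/(h * 1) mulr1 scalerDl addrA.
Qed.

Lemma is_derive_scale_id W (q : R) (w : W) :
  is_derive q 1 (fun q : R => q *: w) w.
Proof.
apply/is_deriveP => e e0; exists 1 => // h _.
by rewrite -[h *: 1]/(h * 1) mulr1 scalerDl addrAC addrK subrr normr0 mulr_ge0// ltW.
Qed.

Lemma differentiable_eps V W (f : V -> W) (x : V) (L : {linear V -> W}) :
  continuous L ->
  (forall e : R, 0 < e -> exists2 r : R, 0 < r &
    forall h, `|h| < r -> `|f (x + h) - f x - L h| <= e * `|h|) ->
  differentiable f x /\ 'd f x = L :> (V -> W).
Proof.
move=> cL H.
have E : f \o shift x = cst (f x) + L +o_ 0 id.
  apply/eqaddoP => e e0; have [r r0 Hr] := H e e0.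
  apply/nbhs_ballP; exists r => //= h; rewrite -ball_normE /= sub0r normrN => hr.
  by have := Hr h hr; rewrite opprD addrA [x + h]addrC.
have dE : 'd f x = L :> (V -> W) by exact: diff_unique.
by split => //; apply/diff_locallyP; rewrite dE.
Qed.

Lemma diff_eps V W (f : V -> W) (x : V) : differentiable f x ->
  forall e : R, 0 < e -> exists2 r : R, 0 < r &
    forall h, `|h| < r -> `|f (x + h) - f x - 'd f x h| <= e * `|h|.
Proof.
move=> /diff_locallyP [_] /eqaddoP H e e0.
have := H e e0 => /nbhs_ballP [r /= r0 Hr]; exists r => // h hr.
have := Hr h; rewrite -ball_normE /= sub0r normrN => /(_ hr).
by rewrite -![(_ - _) _]/(_ - _) -![(_ + _) _]/(_ + _) /= opprD addrA [h + x]addrC.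
Qed.

Lemma diff_is_derive V W (f : V -> W) (x v : V) :
  differentiable f x -> is_derive x v f ('d f x v).
Proof. by move=> df; split; [exact: diff_derivable|rewrite deriveE]. Qed.

End MoreDerivativeTools.

Definition frame_map {R : realType} {V W : normedModType R} (b : frame V)
  (w : 'I_(fr_n b) -> W) (v : V) : W := \sum_i fr_c b i v *: w i.

Section FrameMap.
Context {R : realType} {V W : normedModType R} (b : frame V).
Variable w : 'I_(fr_n b) -> W.

Lemma frame_map_linear : linear (frame_map w).
Proof.
move=> a u v; rewrite /frame_map scaler_sumr -big_split /=.
by apply: eq_bigr => i _; rewrite linearD linearZ /= scalerDl scalerA.
Qed.

HB.instance Definition _ :=
  GRing.isLinear.Build R V W *:%R (frame_map w) frame_map_linear.

Lemma frame_map_continuous : continuous (frame_map w).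
Proof.
move=> v; rewrite /frame_map; apply: cvg_big => [|i _]; first exact: add_continuous.
by apply: cvgZr_tmp; exact: fr_cont.
Qed.

Lemma linear_frame (f : {linear V -> W}) v :
  f v = \sum_i fr_c b i v *: f (fr_v b i).
Proof. by rewrite {1}(frE b v) linear_sum; apply: eq_bigr => i _; rewrite linearZ. Qed.

End FrameMap.

Section C1criterion.
Context {R : realType} {V W : normedModType R} (b : frame V) (bW : frame W).
Local Notation e := (fr_v b).

Lemma mean_value_ineq (h h' : R -> W) (M : R) :
  (forall s : R, 0 <= s <= 1 -> is_derive s 1 h (h' s)) ->
  (forall s : R, 0 <= s <= 1 -> `|h' s| <= M) ->
  `|h 1 - h 0| <= kappa bW * M.
Proof.
move=> dh hM.
have := mean_value_majorant bW (a:=0) (b:=1) (G := M \*: id) (g := fun=> M) ler01 dh.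
rewrite -![(_ \*: _) _]/(_ * _) /= mulr0 mulr1 subr0; apply => // s _.
rewrite -[X in is_derive _ _ _ X]mulr1.
exact: is_deriveZ.
Qed.

(** The increment is split along a list of frame vectors, and on each piece
    the mean value inequality is applied to [f] minus its linearization. *)
Lemma increment_le (f : V -> W) (x : V) (r eps : R) (a : 'I_(fr_n b) -> R)
    (s : seq 'I_(fr_n b)) : 0 <= eps ->
  (forall y, `|y - x| < r -> forall i, derivable f y (e i)) ->
  (forall y, `|y - x| < r -> forall i, `|'D_(e i) f y - 'D_(e i) f x| <= eps) ->
  \sum_(i <- s) `|a i| * `|e i| < r ->
  `|f (x + \sum_(i <- s) a i *: e i) - f x - \sum_(i <- s) a i *: 'D_(e i) f x|
    <= kappa bW * eps * \sum_(i <- s) `|a i|.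
Proof.
move=> eps0 df cf; elim: s => [|i s IH]; rewrite ?big_nil ?big_cons.
  by rewrite addr0 subrr subr0 normr0 mulr0.
move=> Hr; set S := \sum_(j <- s) a j *: e j.
have Hs : \sum_(j <- s) `|a j| * `|e j| < r.
  by apply: le_lt_trans Hr; rewrite lerDr mulr_ge0.
set T := \sum_(j <- s) a j *: 'D_(e j) f x.
have -> : f (x + (a i *: e i + S)) - f x - (a i *: 'D_(e i) f x + T) =
  (f (x + S + 1 *: (a i *: e i)) - 1 *: (a i *: 'D_(e i) f x)
    - (f (x + S + 0 *: (a i *: e i)) - 0 *: (a i *: 'D_(e i) f x)))
  + (f (x + S) - f x - T).
  rewrite !scale0r !scale1r addr0 subr0 [a i *: e i + S]addrC addrA.
  set A := f _; set B := f (x + S); set D := a i *: _.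
  by rewrite [in RHS]addrA subrKA opprD addrA [A - D - f x]addrAC.
rewrite mulrDr; apply: le_trans (ler_normD _ _) _; apply: lerD; last exact: IH.
rewrite -mulrA.
have near_x t : 0 <= t <= 1 -> `|x + S + t *: (a i *: e i) - x| < r.
  move=> /andP[t0 t1]; rewrite [x + S]addrC addrAC addrK addrC.
  apply: le_lt_trans Hr; apply: le_trans (ler_normD _ _) _; apply: lerD.
    by rewrite !normrZ (ger0_norm t0) ler_piMl// mulr_ge0.
  apply: le_trans (ler_norm_sum _ _ _) _; apply: ler_sum => j _.
  by rewrite normrZ.
apply: (@mean_value_ineq
  (fun t => f (x + S + t *: (a i *: e i)) - t *: (a i *: 'D_(e i) f x))
  (fun t => a i *: 'D_(e i) f (x + S + t *: (a i *: e i)) - a i *: 'D_(e i) f x)).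
- move=> t t01; apply: is_deriveB.
    have /(is_deriveZv (a i)) Hd := derivableP (df _ (near_x t t01) i).
    exact: (is_derive_line _ _ _ _ _).1 Hd.
  exact: is_derive_scale_id.
- move=> t t01; rewrite -scalerBr normrZ mulrC ler_wpM2r// cf//.
  exact: near_x.
Qed.

(** Partial derivatives along the frame vectors that exist near [x] and are
    continuous at [x] give the differential; all the smoothness proofs below
    therefore treat finitely many directions only. *)
Lemma C1_differentiable (f : V -> W) (U : set V) (x : V) : open U -> U x ->
  (forall y, U y -> forall i, derivable f y (e i)) ->
  (forall i, {for x, continuous ('D_(e i) f)}) ->
  differentiable f x /\ 'd f x = frame_map (fun i => 'D_(e i) f x) :> (V -> W).
Proof.
move=> oU Ux df cf; apply: differentiable_eps; first exact: frame_map_continuous.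
move=> eps eps0.
pose A := 1 + \sum_i fr_lip b i; pose B := 1 + \sum_i fr_lip b i * `|e i|.
have A0 : 0 < A.
  by rewrite ltr_wpDr// sumr_ge0// => i _; rewrite ltW// fr_lip_gt0.
have B0 : 0 < B := kappa_gt0 b.
have kA0 : 0 < kappa bW * A by rewrite mulr_gt0// kappa_gt0.
have eps'0 : 0 < eps / (kappa bW * A) by rewrite divr_gt0.
have : \forall y \near x, U y /\
    forall i, `|'D_(e i) f y - 'D_(e i) f x| <= eps / (kappa bW * A).
  apply: filterI; first exact: open_nbhs_nbhs.
  apply: filter_forall => i; move/cvgrPdist_le: (cf i) => /(_ _ eps'0).
  by apply: filterS => y; rewrite distrC.
move=> /nbhs_ballP [r /= r0 Hr].
have {}Hr y : `|y - x| < r -> U y /\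
    forall i, `|'D_(e i) f y - 'D_(e i) f x| <= eps / (kappa bW * A).
  by move=> yx; apply: Hr; rewrite -ball_normE /= distrC.
exists (r / B); first exact: divr_gt0.
move=> h; rewrite ltr_pdivlMr// => hr.
have := @increment_le f x r (eps / (kappa bW * A)) (fr_c b ^~ h) (index_enum _)
  (ltW eps'0) _ _ _.
rewrite -frE => H.
apply: (le_trans (H _ _ _)).
- by move=> y /Hr[Uy _] i; apply: df.
- by move=> y /Hr[].
- apply: le_lt_trans hr; rewrite mulrDr mulr1 mulr_sumr.
  apply: (@le_trans _ _ (\sum_i `|h| * (fr_lip b i * `|e i|))); last by rewrite lerDr.
  by apply: ler_sum => i _; rewrite mulrA ler_wpM2r// mulrC fr_lipP.
- rewrite invfM !mulrA [kappa bW * eps]mulrC mulfK; last by rewrite gt_eqF// kappa_gt0.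
  rewrite mulrAC ler_pdivrMr// -mulrA ler_pM2l// mulrDr mulr1 mulr_sumr.
  apply: (@le_trans _ _ (\sum_i `|h| * fr_lip b i)); last by rewrite lerDr.
  by apply: ler_sum => i _; rewrite mulrC fr_lipP.
Qed.

End C1criterion.

(** * Functions of class C^k *)

Section CkBasic.
Context {R : realType}.
Implicit Types V W X : normedModType R.

Lemma derive_ext V W (U : set V) (f g : V -> W) v : open U ->
  (forall x, U x -> f x = g x) -> forall x, U x -> 'D_v f x = 'D_v g x.
Proof.
move=> oU fg x Ux; apply: near_eq_derive; near=> y; apply: fg.
by near: y; exact: open_nbhs_nbhs.
Unshelve. all: by end_near. Qed.

Lemma differentiable_ext V W (U : set V) (f g : V -> W) x : open U ->
  (forall x, U x -> f x = g x) -> U x ->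
  differentiable f x -> differentiable g x /\ 'd g x = 'd f x :> (V -> W).
Proof.
move=> oU fg Ux df; have := open_nbhs_nbhs (conj oU Ux).
move=> /nbhs_ballP [r0 /= r00 Hr0].
apply: differentiable_eps; first exact: diff_continuous.
move=> e e0; have [r rp Hr] := diff_eps df e0.
exists (Num.min r r0); first by rewrite lt_min rp.
move=> h; rewrite lt_min => /andP[hr hr0].
rewrite -!fg//; first exact: Hr.
by apply: Hr0; rewrite -ball_normE /= opprD addrA subrr sub0r normrN.
Qed.

Lemma is_Ck_ext V W k (U : set V) (f g : V -> W) : open U ->
  (forall x, U x -> f x = g x) -> is_Ck k U f -> is_Ck k U g.
Proof.
move=> oU; elim: k f g => [|k IH] f g fg /=.
  move=> cf x Ux; have := cf x Ux.
  rewrite /prop_for /continuous_at -fg//; apply: cvg_trans.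
  apply: near_eq_cvg; near=> y; apply: fg.
  by near: y; exact: open_nbhs_nbhs.
move=> [df cf]; split=> [x Ux|v].
  by have [] := differentiable_ext oU fg Ux (df x Ux).
by apply: IH (cf v); exact: derive_ext.
Unshelve. all: by end_near. Qed.

Lemma is_Ck_sub V W k (U U' : set V) (f : V -> W) :
  U' `<=` U -> is_Ck k U f -> is_Ck k U' f.
Proof.
move=> sU; elim: k f => [|k IH] f /=; first by move=> cf x /sU; exact: cf.
by move=> [df cf]; split=> [x /sU|v]; [exact: df|exact: IH].
Qed.

Lemma is_CkS V W k (U : set V) (f : V -> W) : is_Ck k.+1 U f -> is_Ck k U f.
Proof.
elim: k f => [|k IH] f /=.
  by move=> [df _] x Ux; apply: differentiable_continuous; exact: df.
by move=> [df cf]; split=> // v; apply: IH; exact: cf.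
Qed.

Lemma is_Ck_continuous V W k (U : set V) (f : V -> W) x :
  is_Ck k U f -> U x -> {for x, continuous f}.
Proof. by elim: k => [|k IH]; [exact|move=> /is_CkS]. Qed.

Lemma is_Ck_cst V W k (U : set V) (c : W) : is_Ck k U (cst c : V -> W).
Proof.
elim: k c => [|k IH] c /=; first by move=> x _; exact: cst_continuous.
split=> [x _|v]; first exact: differentiable_cst.
suff -> : 'D_v (cst c) = cst 0 :> (V -> W) by exact: IH.
by apply/funext => x; rewrite derive_cst.
Qed.

Lemma is_Ck_lin V W X k (U : set V) (l : {linear W -> X}) (f : V -> W) :
  open U -> continuous l -> is_Ck k U f -> is_Ck k U (l \o f).
Proof.
move=> oU cl; elim: k f => [|k IH] f /=.
  by move=> cf x Ux; apply: continuous_comp; [exact: cf|exact: cl].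
move=> [df cf]; split=> [x Ux|v].
  by apply: differentiable_comp; [exact: df|exact: linear_differentiable].
apply: is_Ck_ext oU _ (IH _ (cf v)) => x Ux.
have [//|_ ->//] := is_derive_lin cl (_ : is_derive x v f ('D_v f x)).
by apply: derivableP; apply: diff_derivable; exact: df.
Qed.

Lemma is_Ck_add V W k (U : set V) (f g : V -> W) :
  open U -> is_Ck k U f -> is_Ck k U g -> is_Ck k U (fun x => f x + g x).
Proof.
move=> oU; elim: k f g => [|k IH] f g /=.
  by move=> cf cg x Ux; apply: cvgD; [exact: cf|exact: cg].
move=> [df cf] [dg cg]; split=> [x Ux|v].
  by apply: differentiableD; [exact: df|exact: dg].
apply: is_Ck_ext oU _ (IH _ _ (cf v) (cg v)) => x Ux.
apply/esym/deriveD; apply: diff_derivable; [exact: df|exact: dg].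
Qed.

Lemma is_Ck_sum V W k (U : set V) (I : finType) (f : I -> V -> W) (P : pred I) :
  open U -> (forall i, is_Ck k U (f i)) -> is_Ck k U (fun x => \sum_(i | P i) f i x).
Proof.
move=> oU cf.
elim: (index_enum _) => [|i s IH].
  apply: is_Ck_ext oU _ (is_Ck_cst k U 0) => x _; by rewrite big_nil.
have [Pi|Pi] := boolP (P i).
  apply: is_Ck_ext oU _ (is_Ck_add oU (cf i) IH) => x _.
  by rewrite big_cons Pi.
by apply: is_Ck_ext oU _ IH => x _; rewrite big_cons (negbTE Pi).
Qed.

End CkBasic.

Section Scale.
Context {R : realType} {W : normedModType R}.

Lemma scale_bilinear : bilinear_for
    (GRing.Scale.Law.clone _ _ *:%R _) (GRing.Scale.Law.clone _ _ *:%R _)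
    (@GRing.scale R W).
Proof.
split=> [u'|u] a x y /=; first by rewrite scalerDl scalerA.
by rewrite scalerDr !scalerA mulrC.
Qed.

HB.instance Definition _ := bilinear_isBilinear.Build R R W W _ _
  (@GRing.scale R W) scale_bilinear.

(** The Leibniz rule, from the bilinearity of scaling. *)
Lemma diff_scale (V : normedModType R) (a : V -> R) (w : V -> W) x :
  differentiable a x -> differentiable w x ->
  differentiable (fun y => a y *: w y) x /\
  forall v, 'd (fun y => a y *: w y) x v = a x *: 'd w x v + 'd a x v *: w x.
Proof.
move=> da dw.
have cs : continuous (fun p : R * W => p.1 *: p.2).
  by move=> p; exact: scale_continuous.
have ds p : differentiable (fun p : R * W => p.1 *: p.2) p.
  exact: (@differentiable_bilin _ _ _ _ (@GRing.scale R W)).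
have dp := differentiable_pair da dw.
have E : (fun y => a y *: w y) = (fun p : R * W => p.1 *: p.2) \o (fun y => (a y, w y)).
  by [].
rewrite E; split; first exact: differentiable_comp.
move=> v; rewrite diff_comp//= (diff_pair da dw).
by rewrite (@diff_bilin _ _ _ _ (@GRing.scale R W)).
Qed.

End Scale.

Section CkMore.
Context {R : realType}.
Implicit Types V W X : normedModType R.

Lemma is_Ck_scale V W k (U : set V) (a : V -> R) (w : V -> W) :
  open U -> is_Ck k U a -> is_Ck k U w -> is_Ck k U (fun x => a x *: w x).
Proof.
move=> oU; elim: k a w => [|k IH] a w /=.
  by move=> ca cw x Ux; apply: cvgZ; [exact: ca|exact: cw].
move=> Ha Hw; have [da ca] := Ha; have [dw cw] := Hw; split=> [x Ux|v].
  by have [] := diff_scale (da x Ux) (dw x Ux).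
apply: is_Ck_ext oU _ (is_Ck_add oU (IH _ _ (is_CkS Ha) (cw v)) (IH _ _ (ca v) (is_CkS Hw))) => x Ux.
have [dd E] := diff_scale (da x Ux) (dw x Ux).
transitivity ('d (fun y => a y *: w y) x v); last by rewrite deriveE.
by rewrite E (deriveE _ (da x Ux)) (deriveE _ (dw x Ux)).
Qed.

Lemma is_Ck_mul V k (U : set V) (a c : V -> R) :
  open U -> is_Ck k U a -> is_Ck k U c -> is_Ck k U (fun x => a x * c x).
Proof. exact: is_Ck_scale. Qed.

Lemma is_Ck_prod V k (U : set V) (I : finType) (f : I -> V -> R) :
  open U -> (forall i, is_Ck k U (f i)) -> is_Ck k U (fun x => \prod_i f i x).
Proof.
move=> oU cf; elim: (index_enum _) => [|i s IH].
  by apply: is_Ck_ext oU _ (is_Ck_cst k U (1 : R)) => x _; rewrite big_nil.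
by apply: is_Ck_ext oU _ (is_Ck_mul oU (cf i) IH) => x _; rewrite big_cons.
Qed.

Lemma is_Ck_det V k (U : set V) n (A : V -> 'M[R]_n) :
  open U -> (forall i j, is_Ck k U (fun x => A x i j)) ->
  is_Ck k U (fun x => \det (A x)).
Proof.
move=> oU cA; have cp (s : 'S_n) : is_Ck k U (fun x => (-1) ^+ s * \prod_i A x i (s i)).
  apply: (is_Ck_mul oU (is_Ck_cst k U ((-1) ^+ s : R))).
  by apply: (is_Ck_prod oU) => i; exact: cA.
exact: (is_Ck_sum xpredT oU cp).
Qed.

Lemma is_Ck_opp V W k (U : set V) (f : V -> W) :
  open U -> is_Ck k U f -> is_Ck k U (fun x => - f x).
Proof.
move=> oU cf; apply: is_Ck_ext oU _ (is_Ck_scale oU (is_Ck_cst k U (-1 : R)) cf).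
by move=> x _; rewrite /= scaleN1r.
Qed.

Lemma is_Ck_pair V W X k (U : set V) (f : V -> W) (g : V -> X) :
  open U -> is_Ck k U f -> is_Ck k U g -> is_Ck k U (fun x => (f x, g x)).
Proof.
move=> oU; elim: k f g => [|k IH] f g /=.
  by move=> cf cg x Ux; apply: cvg_pair; [exact: cf|exact: cg].
move=> [df cf] [dg cg]; split=> [x Ux|v].
  by apply: differentiable_pair; [exact: df|exact: dg].
apply: is_Ck_ext oU _ (IH _ _ (cf v) (cg v)) => x Ux.
have dd := differentiable_pair (df x Ux) (dg x Ux).
by rewrite (deriveE _ dd) (deriveE _ (df x Ux)) (deriveE _ (dg x Ux)) (diff_pair (df x Ux) (dg x Ux)).
Qed.

Lemma is_Ck_id V k (U : set V) : open U -> is_Ck k U (id : V -> V).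
Proof.
move=> oU; case: k => [|k] /=; first by move=> x _; exact: cvg_id.
split=> [x _|v]; first exact: ex_diff.
apply: is_Ck_ext oU _ (is_Ck_cst k U v) => x _; by rewrite derive_id.
Qed.

Lemma is_Ck_linear V W k (U : set V) (l : {linear V -> W}) :
  open U -> continuous l -> is_Ck k U l.
Proof. by move=> oU cl; apply: (is_Ck_lin oU cl (is_Ck_id k oU)). Qed.

(** The derivative of 1/a is - a' (1/a)^2, which is C^k as soon as 1/a is; this
    gives the induction on the order. *)
Lemma is_Ck_inv V k (U : set V) (a : V -> R) : open U ->
  (forall x, U x -> a x != 0) -> is_Ck k U a -> is_Ck k U (fun x => (a x)^-1).
Proof.
move=> oU a0; elim: k => [|k IH] ca /=.
  by move=> x Ux; apply: cvgV; [exact: a0|exact: ca].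
have iv := IH (is_CkS ca); have {ca} [da ca] := ca.
split=> [x Ux|v]; first by apply: differentiableV; [exact: da|exact: a0].
apply: is_Ck_ext oU _ (is_Ck_opp oU (is_Ck_mul oU (is_Ck_mul oU iv iv) (ca v))).
move=> x Ux; rewrite deriveV; [|exact: a0|by apply: diff_derivable; exact: da].
by rewrite -exprVn expr2 -scaleNr.
Qed.

Lemma is_Ck_diff V W k (U : set V) (f : V -> W) v :
  open U -> is_Ck k.+1 U f -> is_Ck k U (fun x => 'd f x v).
Proof.
move=> oU [df cf]; apply: is_Ck_ext oU _ (cf v) => x Ux.
by rewrite deriveE//; exact: df.
Qed.

(** The counterpart of [C1_differentiable] for higher orders, and the means by
    which flows are shown to be smooth. *)
Lemma is_Ck_frame V W (b : frame V) (bW : frame W) k (U : set V) (f : V -> W) :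
  open U -> (forall x, U x -> forall i, derivable f x (fr_v b i)) ->
  (forall i, is_Ck k U ('D_(fr_v b i) f)) -> is_Ck k.+1 U f.
Proof.
move=> oU df cf.
have H x : U x -> differentiable f x /\
    'd f x = frame_map (fun i => 'D_(fr_v b i) f x) :> (V -> W).
  move=> Ux; apply: (C1_differentiable bW oU Ux df) => i.
  exact: is_Ck_continuous (cf i) Ux.
split=> [x /H[]//|v].
have := @is_Ck_sum _ _ _ k U _ (fun i x => fr_c b i v *: 'D_(fr_v b i) f x) xpredT oU.
move/(_ (fun i => is_Ck_scale oU (is_Ck_cst k U (fr_c b i v)) (cf i))).
apply: is_Ck_ext oU _ => x Ux; have [dd E] := H x Ux.
by rewrite deriveE// E.
Qed.

(** Stability of C^k under composition with [f] is a parameter, because this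
    lemma serves inside the induction that proves that stability. *)
Lemma is_Ck_diff_app V W X (b : frame W) k (U : set V) (U' : set W)
    (g : W -> X) (f v : V -> W) : open U -> open U' ->
  (forall h, is_Ck k U' h -> is_Ck k U ((h : W -> X) \o f)) ->
  is_Ck k.+1 U' g -> (forall x, U x -> U' (f x)) ->
  is_Ck k U v -> is_Ck k U (fun x => 'd g (f x) (v x)).
Proof.
move=> oU oU' Hcomp cg fU cv.
have := @is_Ck_sum _ _ _ k U _
  (fun i x => fr_c b i (v x) *: 'd g (f x) (fr_v b i)) xpredT oU.
have cs i : is_Ck k U (fun x => fr_c b i (v x) *: 'd g (f x) (fr_v b i)).
  apply: (is_Ck_scale oU); first exact: (is_Ck_lin oU (fr_cont b i)).
  by apply: (Hcomp (fun y => 'd g y (fr_v b i))); exact: is_Ck_diff.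
move=> /(_ cs); apply: is_Ck_ext oU _ => x Ux /=.
by rewrite [RHS](linear_frame b).
Qed.

Lemma is_Ck_comp V W X (b : frame W) k (U : set V) (U' : set W)
    (g : W -> X) (f : V -> W) : open U -> open U' ->
  (forall x, U x -> U' (f x)) -> is_Ck k U' g -> is_Ck k U f ->
  is_Ck k U (g \o f).
Proof.
move=> oU oU' fU; elim: k g => [|k IH] g /=.
  by move=> cg cf x Ux; apply: continuous_comp; [exact: cf|apply: cg; exact: fU].
move=> Hg Hf; have [dg cg] := Hg; have [df cf] := Hf; split=> [x Ux|v].
  by apply: differentiable_comp; [exact: df|apply: dg; exact: fU].
have := @is_Ck_diff_app V W X b k U U' g f ('D_v f) oU oU' _ Hg fU (cf v).
move=> /(_ (fun h ch => IH h ch (is_CkS Hf))); apply: is_Ck_ext oU _ => x Ux.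
have dfx := df x Ux; have dgx := dg _ (fU x Ux).
rewrite (deriveE _ dfx) (deriveE _ (differentiable_comp dfx dgx)).
by rewrite (diff_comp dfx dgx).
Qed.

End CkMore.

(** * Products and inner-product spaces have frames *)

Section FrameR.
Context {R : realType}.

Program Definition frame_R : frame R :=
  @Frame R R 1 (fun=> 1) (fun=> (idfun : {linear R -> R})) _ _.
Next Obligation. by move=> ? ?; exact: cvg_id. Qed.
Next Obligation. by move=> x; rewrite big_ord1 /= -[_ *: _]/(_ * _) mulr1. Qed.

End FrameR.

Section FrameProd.
Context {R : realType} {V W : normedModType R} (b : frame V) (c : frame W).

Definition frame_prod_v (i : 'I_(fr_n b + fr_n c)) : V * W :=
  match fintype.split i with inl j => (fr_v b j, 0) | inr j => (0, fr_v c j) end.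

Definition frame_prod_c (i : 'I_(fr_n b + fr_n c)) : {linear (V * W)%type -> R} :=
  match fintype.split i with
  | inl j => ((fr_c b j \o fst) : {linear (V * W)%type -> R})
  | inr j => ((fr_c c j \o snd) : {linear (V * W)%type -> R})
  end.

Lemma frame_prod_cont i : continuous (frame_prod_c i).
Proof.
rewrite /frame_prod_c; case: fintype.split => j /= x;
  apply: continuous_comp; by [exact: cvg_fst|exact: cvg_snd|exact: fr_cont].
Qed.

Lemma frame_prodE x : x = \sum_i frame_prod_c i x *: frame_prod_v i.
Proof.
rewrite big_split_ord /= /frame_prod_c /frame_prod_v.
under eq_bigr do rewrite (unsplitK (inl _)) /=.
under [X in _ + X]eq_bigr do rewrite (unsplitK (inr _)) /=.
case: x => x y /=; rewrite {1}(frE b x) {1}(frE c y).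
apply/eqP; rewrite xpair_eqE /=; apply/andP; split; apply/eqP.
- rewrite (raddf_sum fst) (raddf_sum fst) /= [X in _ + X]big1 ?addr0//.
  by move=> i _; rewrite scaler0.
- rewrite (raddf_sum snd) (raddf_sum snd) /= [X in X + _]big1 ?add0r//.
  by move=> i _; rewrite scaler0.
Qed.

Definition frame_prod : frame (V * W)%type := Frame frame_prod_cont frame_prodE.

End FrameProd.

Section FrameH.
Context {R : realType} {H : innerProductType R}.

(** The square of the norm of <v,v> u - <u,v> v is nonnegative. *)
Lemma cauchy_schwarz (u v : H) : `|inner u v| <= `|u| * `|v|.
Proof.
have [->|v0] := eqVneq v 0; first by rewrite linear0 !normr0 mulr0.
have vv0 : 0 < inner v v by rewrite inner_norm exprn_gt0// normr_gt0.
have : 0 <= inner (inner v v *: u - inner u v *: v) (inner v v *: u - inner u v *: v).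
  by rewrite inner_norm exprn_ge0.
have innerBl a b c : inner (a - b) c = inner a c - inner b c :> R.
  by rewrite ![inner _ c]inner_sym linearB.
have innerZl a b c : inner (a *: b) c = a * inner b c :> R.
  by rewrite ![inner _ c]inner_sym linearZ.
rewrite innerBl !linearB !linearZ /= !innerZl -![_ *: _]/(_ * _) [inner v u]inner_sym => h.
rewrite -(@ler_pXn2r _ 2)// ?nnegrE ?mulr_ge0// real_normK ?num_real// exprMn -!inner_norm.
rewrite -(ler_pM2l vv0); nra.
Qed.

Lemma inner_continuous (u : H) : continuous (inner u : H -> R).
Proof.
apply: ((linear_bounded_continuous (inner u : {linear H -> R^o})).1 _).
apply/linear_boundedP; near=> r => x.
by apply: le_trans (cauchy_schwarz u x) _; rewrite ler_wpM2r.
Unshelve. all: by end_near. Qed.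

Program Definition frame_H : frame H :=
  @Frame R H (\dim (fullv : {vspace H})) (fun i => (vbasis fullv)`_i)
    (fun i => (coord (vbasis (fullv : {vspace H})) i : {linear H -> R^o})) _ _.
Next Obligation.
move=> i.
have [g gE] := riesz (coord (vbasis (fullv : {vspace H})) i : {linear H -> R^o}).
have E : (inner g : H -> R) = (fun v => coord (vbasis (fullv : {vspace H})) i v).
  by apply: funext => v; rewrite gE.
by have := @inner_continuous g; rewrite E.
Qed.
Next Obligation. by move=> x; apply: coord_vbasis; rewrite memvf. Qed.

End FrameH.

(** * Compact convex neighbourhoods *)

Section Box.
Context {R : realType} {V : normedModType R} (b : frame V).

Definition box_point (x0 : V) (a : 'rV[R]_(fr_n b)) : V :=
  x0 + \sum_i a 0 i *: fr_v b i.

(** The image of a cube in coordinate space, hence compact and convex even when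
    the coordinates of a vector in the frame are not unique. *)
Definition box (x0 : V) (r : R) : set V :=
  box_point x0 @` [set a : 'rV[R]_(fr_n b) | forall i, `[- r, r]%classic (a ord0 i)].

Lemma box_pointP x0 r y : (forall i, `|fr_c b i (y - x0)| <= r) -> box x0 r y.
Proof.
move=> h; exists (\row_i fr_c b i (y - x0)).
  by move=> i; rewrite mxE /= in_itv /= -ler_norml.
rewrite /box_point; under eq_bigr do rewrite mxE.
by rewrite -(frE b) subrKC.
Qed.

Lemma box_compact x0 r : compact (box x0 r).
Proof.
apply: continuous_compact; last first.
  apply: (@rV_compact _ _ (fun=> `[- r, r]%classic)) => i.
  exact: segment_compact.
have cs : continuous (fun a : 'rV[R]_(fr_n b) => \sum_i a 0 i *: fr_v b i).
  apply: continuous_big => [|i _]; first exact: add_continuous.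
  have cc (v : V) : continuous (fun s : R => s *: v).
    by move=> s; apply: cvgZr_tmp; exact: cvg_id.
  have cc1 : continuous (fun a : 'rV[R]_(fr_n b) => a 0 i) by exact: coord_continuous.
  by move=> a; exact: (continuous_comp (cc1 a) (cc _ _)).
have cD : continuous (fun y => x0 + y).
  by move=> y; apply: cvgD; [exact: cvg_cst|exact: cvg_id].
by apply: continuous_subspaceT => a; exact: (continuous_comp (cs a) (cD _)).
Qed.

Definition cvx_set (K : set V) := forall (x y : V) (s : R), K x -> K y ->
  0 <= s <= 1 -> K (x + s *: (y - x)).

Lemma box_convex x0 r : cvx_set (box x0 r).
Proof.
move=> _ _ s [a ar <-] [c cr <-] /andP[s0 s1].
exists (a + s *: (c - a)).
  move=> i; rewrite !mxE; have := ar i; have := cr i; rewrite /= !in_itv /=.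
  move=> /andP[? ?] /andP[? ?]; nra.
rewrite /box_point opprD addrACA subrr add0r -sumrB scaler_sumr -addrA.
rewrite -big_split /=; congr (_ + _); apply: eq_bigr => i _.
by rewrite !mxE -scalerBl scalerA -scalerDl.
Qed.

Lemma box_norm x0 r y : 0 <= r -> box x0 r y ->
  `|y - x0| <= r * \sum_i `|fr_v b i|.
Proof.
move=> r0 [a ar <-]; rewrite /box_point addrC addKr mulr_sumr.
apply: le_trans (ler_norm_sum _ _ _) _; apply: ler_sum => i _.
rewrite normrZ ler_wpM2r//.
by have := ar i; rewrite /= in_itv /= -ler_norml.
Qed.

Lemma box_nbhs x0 r : 0 < r -> \forall y \near x0, forall i, `|fr_c b i (y - x0)| <= r.
Proof.
move=> r0; apply: filter_forall => i.
have /cvgrPdist_le/(_ _ r0) := fr_cont b i x0.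
by apply: filterS => y; rewrite -linearB -normrN -linearN opprB.
Qed.

Lemma box_sub (U : set V) x0 : open U -> U x0 ->
  exists2 r : R, 0 < r & box x0 r `<=` U.
Proof.
move=> oU Ux0; have /nbhs_ballP [e /= e0 He] := open_nbhs_nbhs (conj oU Ux0).
have B0 : 0 < 1 + \sum_i `|fr_v b i| by rewrite ltr_wpDr// sumr_ge0.
exists (e / (1 + \sum_i `|fr_v b i|) / 2); first by rewrite !divr_gt0.
move=> y yb; apply: He; rewrite -ball_normE /= distrC.
have := box_norm _ yb.
have r0 : 0 < e / (1 + \sum_i `|fr_v b i|) by rewrite divr_gt0.
move=> /(_ (ltW (divr_gt0 r0 (ltr0Sn _ 1)))) h; apply: le_lt_trans h _.
have S0 : 0 <= \sum_i `|fr_v b i| by rewrite sumr_ge0.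
set S := \sum_i _ in S0 B0 r0 *.
have : e / (1 + S) * (1 + S) = e by rewrite divfK// gt_eqF.
by nra.
Qed.

Definition clamp (r s : R) : R := Num.max (- r) (Num.min r s).

(** A Lipschitz map onto the box that fixes the points with small coordinates.
    Composed with it, a field that is smooth near [x0] becomes globally
    Lipschitz. *)
Definition retract (x0 : V) (r : R) (x : V) : V :=
  x0 + \sum_i clamp r (fr_c b i (x - x0)) *: fr_v b i.

Lemma clamp_itv r s : 0 <= r -> - r <= clamp r s <= r.
Proof.
move=> r0; rewrite /clamp le_max lexx ge_max ge_min lexx /=.
by rewrite andbT; lra.
Qed.

Lemma clamp_lip r s t : 0 <= r -> `|clamp r s - clamp r t| <= `|s - t|.
Proof.
move=> r0.
have H u : [\/ u <= - r /\ clamp r u = - r, - r <= u <= r /\ clamp r u = u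
             | r <= u /\ clamp r u = r].
  rewrite /clamp; have [h|h] := leP r u.
    by constructor 3; split => //; rewrite max_r//; lra.
  have [h'|h'] := leP (- r) u.
    by constructor 2; rewrite (ltW h).
  by constructor 1; rewrite (ltW h').
rewrite ler_norml; have := ler_norm (s - t); have := ler_norm (t - s).
rewrite (distrC t).
by case: (H s) => -[h1 ->]; case: (H t) => -[h2 ->] h3 h4; apply/andP; split; lra.
Qed.

Lemma clamp_id r s : `|s| <= r -> clamp r s = s.
Proof. by rewrite ler_norml /clamp => /andP[? ?]; rewrite min_r// max_r. Qed.

Lemma retract_box x0 r x : 0 <= r -> box x0 r (retract x0 r x).
Proof.
move=> r0; exists (\row_i clamp r (fr_c b i (x - x0))).
  by move=> i; rewrite mxE /= in_itv /= clamp_itv.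
by rewrite /box_point; under eq_bigr do rewrite mxE.
Qed.

Lemma retract_id x0 r x : (forall i, `|fr_c b i (x - x0)| <= r) ->
  retract x0 r x = x.
Proof.
move=> h; rewrite /retract; under eq_bigr do rewrite clamp_id//.
by rewrite -(frE b) subrKC.
Qed.

Lemma retract_lip x0 r x y : 0 <= r ->
  `|retract x0 r x - retract x0 r y| <= kappa b * `|x - y|.
Proof.
move=> r0; rewrite /retract opprD addrACA subrr add0r -sumrB /kappa mulrDl mul1r.
apply: (@le_trans _ _ (\sum_i fr_lip b i * `|fr_v b i| * `|x - y|)); last first.
  by rewrite -mulr_suml lerDr.
apply: le_trans (ler_norm_sum _ _ _) _; apply: ler_sum => i _.
rewrite -scalerBl normrZ mulrAC ler_wpM2r//.
apply: le_trans (clamp_lip _ _ r0) _; rewrite -linearB opprD addrACA opprK.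
by rewrite [- x0 + x0]addrC subrr addr0 fr_lipP.
Qed.

End Box.

Lemma compact_bounded_on {R : realType} {V W : normedModType R} (K : set V)
    (f : V -> W) : compact K -> (forall x, K x -> {for x, continuous f}) ->
  exists2 M : R, 0 < M & forall x, K x -> `|f x| <= M.
Proof.
move=> cK cf; have [[x0 Kx0]|K0] := pselect (K !=set0); last first.
  by exists 1 => // x Kx; case: K0; exists x.
have cn : {within K, continuous (fun x => `|f x|)}.
  apply: continuous_in_subspaceT => x; rewrite inE => Kx.
  by apply: cvg_norm; exact: cf.
have [c _ H] := compact_EVT_max (ex_intro _ _ Kx0) cK cn.
exists (`|f c| + 1); first by rewrite ltr_wpDl.
by move=> x Kx; rewrite (le_trans (H x _)) ?inE// lerDl.
Qed.

(** * Primitives of continuous curves *)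

Section Primitive.
Context {R : realType}.

(** The integral starts at [- T] and the constant is corrected afterwards, so
    that the fundamental theorem applies on both sides of 0. *)
Lemma primitive_real (g : R -> R) (T M : R) : 0 < T ->
  (forall t : R, `|t| < T -> {for t, continuous g}) ->
  (forall t : R, `|t| < T -> `|g t| <= M) ->
  exists F : R -> R, F 0 = 0 /\ forall t : R, `|t| < T -> is_derive t 1 F (g t).
Proof.
move=> T0 cg bg.
pose mu := @lebesgue_measure R.
pose I t := (\int[mu]_(s in [set` Interval (BRight (- T)) (BRight t)]) g s)%R.
exists (fun t => I t - I 0); split; first by rewrite subrr.
move=> t tT; have := tT; rewrite ltr_norml => /andP[Tt tT'].
pose u := (t + T) / 2.
have tu : t < u by rewrite /u; lra.
have uT : u < T by rewrite /u; lra.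
have inT s : s \in `]- T, u] -> `|s| < T.
  by rewrite in_itv /= ltr_norml => /andP[-> su]; exact: le_lt_trans su uT.
have mg : measurable_fun (`]- T, u]%classic : set R) g.
  apply: (@measurable_funS _ _ _ _ (`]- T, T[%classic)) => //.
    by apply: subset_itvl; rewrite bnd_simp.
  apply: subspace_continuous_measurable_fun => //.
  apply: continuous_in_subspaceT => x; rewrite inE /= in_itv /= -ltr_norml => xT; exact: cg.
have ig : mu.-integrable [set` Interval (BRight (- T)) (BRight u)] (EFin \o g).
  apply: measurable_bounded_integrable => //.
    by rewrite /= lebesgue_measure_itv /=; case: ifP => _; rewrite ?ltry.
  exists M; split; first exact: num_real.
  by move=> x Mx s /= su; rewrite (le_trans (bg _ (inT _ su)))// ltW.
have Tt' : (BRight (- T) < BRight t)%O by rewrite bnd_simp.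
have [dI EI] := continuous_FTC1 tu ig Tt' (cg t tT).
have : is_derive t 1 I (g t) by split; [exact: dI|rewrite -derive1E EI].
move=> d1; have := is_deriveB d1 (is_derive_cst (I 0) t 1); rewrite subr0.
by [].
Qed.

Lemma primitive_vec (V : normedModType R) (b : frame V) (g : R -> V) (T M : R) :
  0 < T ->
  (forall t : R, `|t| < T -> {for t, continuous g}) ->
  (forall t : R, `|t| < T -> `|g t| <= M) ->
  exists F : R -> V, F 0 = 0 /\ forall t : R, `|t| < T -> is_derive t 1 F (g t).
Proof.
move=> T0 cg bg.
have /choice [F HF] i : exists F : R -> R, F 0 = 0 /\
    forall t : R, `|t| < T -> is_derive t 1 F (fr_c b i (g t)).
  apply: (@primitive_real (fun t => fr_c b i (g t)) T (fr_lip b i * M)); [exact: T0| |] => t tT.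
    exact: (continuous_comp (cg t tT) (fr_cont b i _)).
  by rewrite (le_trans (fr_lipP _ _ _))// ler_pM2l ?fr_lip_gt0// bg.
exists (fun t => \sum_i F i t *: fr_v b i); split.
  by apply: big1 => i _; rewrite (HF i).1 scale0r.
move=> t tT; rewrite {1}(frE b (g t)).
have -> : (fun t => \sum_i F i t *: fr_v b i) = \sum_i (fun t => F i t *: fr_v b i).
  by apply/funext => s; rewrite fct_sumE.
apply: is_derive_sum => i.
pose l := (fun s : R => s *: fr_v b i).
have ll : linear l by move=> a x y; rewrite /l scalerDl scalerA.
pose lM := GRing.isLinear.Build _ _ _ _ _ ll.
pose L : {linear R -> V} := HB.pack l lM.
apply: (@is_derive_lin _ _ _ _ L (F i)); last exact: (HF i).2.
by move=> s; apply: cvgZr_tmp; exact: cvg_id.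
Qed.

End Primitive.

(** * Growth estimates for curves *)

Section Gronwall.
Context {R : realType} {V : normedModType R} (b : frame V).

Lemma is_derive_opp_comp (h : R -> V) (s : R) (d : V) :
  is_derive (- s) 1 h d -> is_derive s 1 (fun t => h (- t)) (- d).
Proof.
move=> /is_deriveP H; apply/is_deriveP => e e0; have [r r0 Hr] := H e e0.
exists r => // t tr; have := Hr (- t); rewrite normrN => /(_ tr).
rewrite -![_ *: 1]/(_ * 1) !mulr1 opprD scaleNr -scalerN.
by [].
Qed.

(** The majorant depends on the absolute value of the time, which makes one
    statement serve both directions of time. *)
Lemma growth (h h' : R -> V) (G g : R -> R) (t : R) :
  (forall s : R, `|s| <= `|t| -> is_derive s 1 h (h' s)) ->
  (forall s : R, 0 <= s <= `|t| -> is_derive s 1 G (g s)) ->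
  (forall s : R, `|s| <= `|t| -> `|h' s| <= g `|s|) ->
  `|h t - h 0| <= kappa b * (G `|t| - G 0).
Proof.
move=> dh dG hg; have [t0|t0] := leP 0 t.
  rewrite ger0_norm// in dh dG hg *.
  apply: (mean_value_majorant b (h' := h') (g := g)) => // s /andP[s0 st].
  - by apply: dh; rewrite ger0_norm.
  - by rewrite -[in leRHS](ger0_norm s0) hg// ger0_norm.
rewrite ltr0_norm// in dh dG hg *.
have := @mean_value_majorant _ _ b (fun s => h (- s)) (fun s => - h' (- s)) G g 0 (- t).
rewrite oppr0 opprK; apply; first by rewrite lerNr oppr0 ltW.
- move=> s /andP[s0 st]; apply: is_derive_opp_comp; apply: dh.
  by rewrite normrN ger0_norm.
- move=> s /andP[s0 st]; rewrite normrN -[in leRHS](ger0_norm s0) -(normrN s) hg//.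
  by rewrite normrN ger0_norm.
Qed.

Lemma growth_cst (h h' : R -> V) (M t : R) :
  (forall s : R, `|s| <= `|t| -> is_derive s 1 h (h' s)) ->
  (forall s : R, `|s| <= `|t| -> `|h' s| <= M) ->
  `|h t - h 0| <= kappa b * M * `|t|.
Proof.
move=> dh hM; have := growth dh (G := M \*: id) (g := fun=> M) _ hM.
rewrite -![(_ \*: _) _]/(_ * _) /= mulr0 subr0 mulrA; apply => s _.
rewrite -[X in is_derive _ _ _ X]mulr1.
exact: is_deriveZ.
Qed.

Lemma growth_exp (h h' : R -> V) (A l t : R) : 0 <= A -> 0 < l ->
  (forall s : R, `|s| <= `|t| -> is_derive s 1 h (h' s)) ->
  (forall s : R, `|s| <= `|t| -> `|h' s| <= A * expR (l * `|s|)) ->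
  `|h t - h 0| <= kappa b * (A / l) * expR (l * `|t|).
Proof.
move=> A0 l0 dh hA.
have dG (s : R) : is_derive s (1 : R) ((A / l) \*: (fun s : R => expR (l * s))) (A * expR (l * s)).
  have -> : A * expR (l * s) = (A / l) *: (expR (l * s) * l).
    by rewrite -[_ *: _]/(_ * _) mulrCA divfK ?gt_eqF// mulrC.
  apply: is_deriveZ.
  have dl : is_derive s 1 ( *%R l) l.
    by rewrite -[X in is_derive _ _ _ X]mulr1; exact: is_deriveZ.
  by apply: (is_derive1_comp (f := expR) (g := *%R l)).
have := growth dh (fun s _ => dG s) hA.
move=> H; apply: le_trans H _; rewrite -!mulrA ler_pM2l ?kappa_gt0//.
rewrite -![(_ \*: _) _]/(_ * _) mulr0 expR0 mulr1 -mulrA.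
by rewrite lerBlDr lerDl divr_ge0// ltW.
Qed.

(** At a point where [expR (- l * `|s|) * `|e s|] is maximal, [growth_exp]
    bounds this maximum by half of itself plus the data, for the rate
    [l = 2 * kappa b * (L + 1)]. *)
Lemma gronwall (e e' : R -> V) (L eps t : R) : 0 <= L -> 0 <= eps ->
  (forall s : R, `|s| <= `|t| -> is_derive s 1 e (e' s)) ->
  (forall s : R, `|s| <= `|t| -> `|e' s| <= L * `|e s| + eps) ->
  `|e t| <= (2 * `|e 0| + eps) * expR (2 * kappa b * (L + 1) * `|t|).
Proof.
move=> L0 eps0 de He; set l := 2 * kappa b * (L + 1).
have k0 := kappa_gt0 b.
have l0 : 0 < l by rewrite /l !mulr_gt0// ltr_wpDl.
pose w s := expR (- (l * `|s|)) * `|e s|.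
have inI s : s \in `[- `|t|, `|t|] -> `|s| <= `|t| by rewrite in_itv /= ler_norml.
have cw : {within `[- `|t|, `|t|], continuous w}.
  apply: continuous_in_subspaceT => s; rewrite inE => /inI st.
  apply: cvgM.
    apply: continuous_comp; last exact: continuous_expR.
    by apply: cvgN; apply: cvgMl_tmp; apply: cvg_norm; exact: cvg_id.
  apply: cvg_norm; apply: differentiable_continuous; apply/derivable1_diffP.
  by have [] := de s st.
have tt : - `|t| <= `|t| by rewrite (@le_trans _ _ 0)// oppr_le0.
have [c /inI ct Hc] := EVT_max tt cw.
have es s : `|s| <= `|t| -> `|e s| <= w c * expR (l * `|s|).
  move=> st; have := Hc s; rewrite in_itv /= -ler_norml => /(_ st).
  by rewrite /w expRN ler_pdivrMl ?expR_gt0// mulrC.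
have wc0 : 0 <= w c by rewrite mulr_ge0// expR_ge0.
have : `|e c - e 0| <= kappa b * ((L * w c + eps) / l) * expR (l * `|c|).
  apply: growth_exp => //; first by rewrite addr_ge0// mulr_ge0.
    by move=> s sc; apply: de; exact: le_trans ct.
  move=> s sc; have st := le_trans sc ct; apply: le_trans (He s st) _.
  rewrite mulrDl lerD//; first by rewrite -mulrA ler_wpM2l// es.
  by rewrite ler_peMr// -expR0 ler_expR mulr_ge0// ltW.
have wcE : `|e c| = w c * expR (l * `|c|).
  by rewrite /w mulrC mulrA -expRD subrr expR0 mul1r.
set E := expR (l * `|c|).
have E1 : 1 <= E by rewrite /E -expR0 ler_expR mulr_ge0// ltW.
have lE : kappa b * ((L * w c + eps) / l) <= (w c + eps) / 2.
  rewrite mulrA ler_pdivrMr// /l.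
  have L1 : 0 < L + 1 by rewrite ltr_wpDl.
  have -> : (w c + eps) / 2 * (2 * kappa b * (L + 1)) =
    kappa b * ((w c + eps) * (L + 1)) by field.
  by rewrite ler_pM2l//; nra.
move=> H.
have {}H : w c * E <= `|e 0| + (w c + eps) / 2 * E.
  rewrite -wcE; apply: (@le_trans _ _ (`|e 0| + `|e c - e 0|)).
    by rewrite -[in leLHS](subrKC (e 0) (e c)) ler_normD.
  rewrite lerD2l; apply: le_trans H _; rewrite ler_wpM2r//; lra.
have : w c <= 2 * `|e 0| + eps.
  have E0 : 0 < E by lra.
  rewrite -(ler_pM2r E0).
  have := normr_ge0 (e 0); nra.
move=> Hw; apply: le_trans (es t (lexx _)) _.
by rewrite ler_wpM2r ?expR_ge0.
Qed.

End Gronwall.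

(** * Existence of solutions of differential equations *)

Lemma open_norm_lt {R : realType} (T : R) : open [set t : R | `|t| < T].
Proof.
have -> : [set t : R | `|t| < T] = (fun t : R => `|t|) @^-1` [set x | x < T] by [].
apply: open_comp => [x _|]; [exact: norm_continuous|exact: open_lt].
Qed.

Lemma near_norm_lt {R : realType} (T t : R) : `|t| < T -> \forall s \near t, `|s| < T.
Proof. by move=> tT; apply: open_nbhs_nbhs; split => //; exact: open_norm_lt. Qed.

Section GeometricLimit.
Context {R : realType}.

Lemma le_geometric_le0 (x C : R) : (forall n, x <= C / 2 ^+ n) -> x <= 0.
Proof.
move=> H; rewrite leNgt; apply/negP => x0.
have C0 : 0 < C by have := H 0; rewrite expr0 divr1; apply: lt_le_trans.
pose n := Num.bound (C / x).
have Hn : C / x < n%:R by rewrite archi_boundP// ltW// divr_gt0.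
have := H n; rewrite ler_pdivlMr ?exprn_gt0//.
move: Hn; rewrite ltr_pdivrMr// => h1 h2.
have h3 : (n%:R : R) <= 2 ^+ n by rewrite -natrX ler_nat ltnW// ltn_expl.
nra.
Qed.

(** The limit is the supremum of the nondecreasing sequence of the lower
    bounds a n - 2 A / 2^n. *)
Lemma geometric_limit_real (a : nat -> R) (A : R) : 0 <= A ->
  (forall n, `|a n.+1 - a n| <= A / 2 ^+ n) ->
  exists l, forall n, `|a n - l| <= 2 * A / 2 ^+ n.
Proof.
move=> A0 H.
pose q n : R := A / 2 ^+ n.
have q0 n : 0 <= q n by rewrite divr_ge0// exprn_ge0.
have qS n : q n.+1 = q n / 2 by rewrite /q exprSr invfM mulrA.
have {}H n : `|a n.+1 - a n| <= q n by exact: H.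
have lo n k : a n - 2 * q n <= a (n + k)%N - 2 * q (n + k)%N.
  elim: k => [|k IH]; first by rewrite addn0.
  apply: le_trans IH _; rewrite addnS qS.
  have := H (n + k)%N; rewrite ler_norml => /andP[? ?]; lra.
have up n k : a (n + k)%N + 2 * q (n + k)%N <= a n + 2 * q n.
  elim: k => [|k IH]; first by rewrite addn0.
  apply: le_trans _ IH; rewrite addnS qS.
  have := H (n + k)%N; rewrite ler_norml => /andP[? ?]; lra.
have cross n m : a n - 2 * q n <= a m + 2 * q m.
  have := lo n m; have := up m n; have := q0 (n + m)%N; rewrite [(m + n)%N]addnC; lra.
pose S := [set a n - 2 * q n | n in [set: nat]].
have S0 : S !=set0 by exists (a 0%N - 2 * q 0%N), 0%N.
have ubS m : ubound S (a m + 2 * q m) by move=> _ [n _ <-]; exact: cross.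
exists (sup S) => n.
have h1 : a n - 2 * q n <= sup S.
  by apply: ub_le_sup; [exists (a 0%N + 2 * q 0%N)|exists n].
have h2 : sup S <= a n + 2 * q n by exact: ge_sup.
rewrite -mulrA -/(q n) ler_norml; apply/andP; split; lra.
Qed.

Lemma geometric_limit (V : normedModType R) (b : frame V) (u : nat -> V) (A : R) :
  0 <= A -> (forall n, `|u n.+1 - u n| <= A / 2 ^+ n) ->
  exists l, forall n, `|u n - l| <= kappa b * (2 * A) / 2 ^+ n.
Proof.
move=> A0 H.
have /choice [l Hl] i : exists l, forall n,
    `|fr_c b i (u n) - l| <= 2 * (fr_lip b i * A) / 2 ^+ n.
  apply: geometric_limit_real; first by rewrite mulr_ge0// ltW// fr_lip_gt0.
  move=> n; rewrite -linearB; apply: le_trans (fr_lipP _ _ _) _.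
  by rewrite -mulrA ler_pM2l ?fr_lip_gt0.
exists (\sum_i l i *: fr_v b i) => n.
rewrite {1}(frE b (u n)) -sumrB.
have A2 : 0 <= 2 * A / 2 ^+ n by rewrite divr_ge0 ?mulr_ge0// exprn_ge0.
apply: (@le_trans _ _ (\sum_i fr_lip b i * `|fr_v b i| * (2 * A / 2 ^+ n))); last first.
  by rewrite -mulr_suml -[leRHS]mulrA ler_wpM2r// lerDr.
apply: le_trans (ler_norm_sum _ _ _) _; apply: ler_sum => i _.
rewrite -scalerBl normrZ mulrAC ler_wpM2r//.
apply: le_trans (Hl i n) _; rewrite !mulrA [2 * fr_lip b i]mulrC.
by [].
Qed.

End GeometricLimit.

Section Existence.
Context {R : realType} {V : normedModType R} (b : frame V).
Variables (f : R -> V -> V) (T L M : R) (x0 : V).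
Hypotheses (T0 : 0 < T) (L0 : 0 <= L).
Hypothesis f_lip : forall (t : R) x y, `|t| < T -> `|f t x - f t y| <= L * `|x - y|.
Hypothesis f_cont : forall u : R -> V,
  (forall t : R, `|t| < T -> {for t, continuous u}) ->
  forall t : R, `|t| < T -> {for t, continuous (fun s => f s (u s))}.
Hypothesis f_bound : forall t : R, `|t| < T -> `|f t x0| <= M.

Let good (u : R -> V) := (forall t : R, `|t| < T -> {for t, continuous u}) /\
  exists B : R, forall t : R, `|t| < T -> `|u t| <= B.

Let f_good u : good u -> exists B : R, forall t : R, `|t| < T -> `|f t (u t)| <= B.
Proof.
move=> [_ [B uB]]; exists (M + L * (B + `|x0|)) => t tT.
rewrite -(subrKC (f t x0) (f t (u t))).
apply: le_trans (ler_normD _ _) _; apply: lerD; first exact: f_bound.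
apply: le_trans (f_lip _ _ tT) _; rewrite ler_wpM2l//.
by apply: le_trans (ler_normB _ _) _; rewrite lerD2r uB.
Qed.

Let prim_exists u : exists F : R -> V, good u ->
  F 0 = 0 /\ forall t : R, `|t| < T -> is_derive t 1 F (f t (u t)).
Proof.
have [gu|ngu] := pselect (good u); last by exists (cst 0).
have [B fB] := f_good gu.
have [F HF] := primitive_vec b T0 (f_cont gu.1) fB.
by exists F.
Qed.

(** Picard iteration. In the norm weighted by [expR (l * `|t|)] the Picard
    operator halves distances however large [T] and [L] are. The solution thus
    exists on the whole interval, which is what linear equations along a given
    orbit require. *)
Lemma ode_exists : exists u : R -> V,
  u 0 = x0 /\ forall t : R, `|t| < T -> is_derive t 1 u (f t (u t)).
Proof.
have [P HP] := choice prim_exists.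
pose step u t := x0 + P u t.
have le_T (s t : R) : `|t| < T -> `|s| <= `|t| -> `|s| < T.
  by move=> tT /le_lt_trans; apply.
have d_step u (t : R) : good u -> `|t| < T -> is_derive t 1 (step u) (f t (u t)).
  move=> gu tT; have := (HP u gu).2 t tT => dP.
  by rewrite -[f t _]add0r; exact: is_deriveD.
have step0 u : good u -> step u 0 = x0.
  by move=> gu; rewrite /step (HP u gu).1 addr0.
have k0 := kappa_gt0 b.
have good_step u : good u -> good (step u).
  move=> gu; split=> [t tT|].
    apply: differentiable_continuous; apply/derivable1_diffP.
    by have [] := d_step u t gu tT.
  have [B fB] := f_good gu.
  have B0 : 0 <= B by apply: le_trans (fB 0 _); rewrite ?normr0.
  exists (`|x0| + kappa b * B * T) => t tT.
  rewrite -(subrKC x0 (step u t)).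
  apply: le_trans (ler_normD _ _) _; rewrite lerD2l -[X in _ - X](step0 u gu).
  apply: (@le_trans _ _ (kappa b * B * `|t|)).
    apply: (@growth_cst _ _ b (step u) (fun s => f s (u s))) => s st.
      exact: d_step gu (le_T _ _ tT st).
    exact: fB (le_T _ _ tT st).
  by rewrite ler_wpM2l ?(ltW tT)// mulr_ge0// ltW.
pose l := 2 * kappa b * (L + 1).
have l0 : 0 < l by rewrite /l !mulr_gt0// ltr_wpDl.
pose E := expR (l * T).
have expE (t : R) : `|t| < T -> 1 <= expR (l * `|t|) <= E.
  move=> tT; rewrite -expR0 !ler_expR mulr_ge0 ?(ltW l0)//=.
  by rewrite ler_wpM2l// ltW.
have E0 : 0 < E := expR_gt0 _.
have contr u v (A : R) : good u -> good v -> 0 <= A ->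
    (forall t : R, `|t| < T -> `|u t - v t| <= A * expR (l * `|t|)) ->
    forall t : R, `|t| < T -> `|step u t - step v t| <= A / 2 * expR (l * `|t|).
  move=> gu gv A0 uv t tT.
  have := @growth_exp _ _ b (step u - step v) (fun s => f s (u s) - f s (v s)) (L * A) l t.
  rewrite -![(_ - _) _]/(_ - _) !step0// subrr subr0 => H.
  apply: le_trans (H _ _ _ _) _ => //.
  - by rewrite mulr_ge0.
  - by move=> s st; apply: is_deriveB; apply: d_step => //; exact: le_T tT st.
  - move=> s st; have sT := le_T _ _ tT st.
    apply: le_trans (f_lip _ _ sT) _; rewrite -mulrA ler_wpM2l//.
    exact: uv.
  - rewrite ler_wpM2r ?expR_ge0// /l.
    have L1 : 0 < L + 1 by rewrite ltr_wpDl.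
    have -> : kappa b * (L * A / (2 * kappa b * (L + 1))) = A / 2 * (L / (L + 1)).
      by field; rewrite !gt_eqF.
    rewrite ler_piMr// ?divr_ge0// ler_pdivrMr// mul1r; lra.
pose un n := iter n step (cst x0).
have good_un n : good (un n).
  elim: n => [|n IH]; last exact: good_step.
  split; first by move=> t _; exact: cst_continuous.
  by exists `|x0|.
have M0 : 0 <= M by apply: le_trans (f_bound (t := 0) _); rewrite ?normr0.
pose A0 := kappa b * M * T.
have A0ge : 0 <= A0 by rewrite !mulr_ge0// ltW.
have un_diff n (t : R) : `|t| < T -> `|un n.+1 t - un n t| <= A0 / 2 ^+ n * expR (l * `|t|).
  elim: n t => [|n IH] t tT.
    rewrite /un /= expr0 divr1.
    have := @growth_cst _ _ b (step (cst x0)) (fun s => f s x0) M t.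
    rewrite (step0 _ (good_un 0%N)) => H.
    apply: le_trans (H _ _) _.
    - by move=> s st; apply: (d_step (cst x0)); [exact: (good_un 0%N)|exact: le_T tT st].
    - by move=> s st; apply: f_bound; exact: le_T tT st.
    - have /andP[e1 _] := expE t tT.
      apply: (@le_trans _ _ A0); last by rewrite ler_peMr.
      by rewrite /A0 ler_wpM2l ?(ltW tT)// mulr_ge0// ltW.
  rewrite exprSr invfM mulrA; apply: (contr (un n.+1) (un n) (A0 / 2 ^+ n)) => //.
  by rewrite divr_ge0// exprn_ge0.
have /choice [u Hu] (t : R) : exists lt, `|t| < T ->
    forall n, `|un n t - lt| <= kappa b * (2 * (A0 * E)) / 2 ^+ n.
  have [tT|nt] := boolP (`|t| < T); last by exists 0.
  have AE : 0 <= A0 * E by rewrite mulr_ge0// ltW.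
  have [|lt Hlt] := @geometric_limit _ _ b (un ^~ t) _ AE; last by exists lt.
  move=> n; apply: le_trans (un_diff n t tT) _.
  rewrite mulrAC ler_wpM2r ?invr_ge0 ?exprn_ge0// ler_wpM2l//.
  by have /andP[] := expE t tT.
(* [D] bounds the distance of the iterates to the limit uniformly in time. *)
pose D := kappa b * (2 * (A0 * E)).
have D0 : 0 <= D by rewrite /D !mulr_ge0// ltW.
have gu : good u.
  split.
    move=> t tT; apply/cvgrPdist_le => e e0.
    have [n Hn] : exists n, D / 2 ^+ n <= e / 3.
      apply: contrapT => /forallNP Hn.
      have : e / 3 <= 0; last lra.
      apply: (@le_geometric_le0 _ _ D) => n; have /negP := Hn n.
      by rewrite -ltNge => /ltW.
    have /cvgrPdist_le/(_ (e / 3)) := (good_un n).1 t tT.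
    rewrite divr_gt0// => /(_ isT) Hc.
    near=> s.
    have sT : `|s| < T.
      by near: s; exact: near_norm_lt.
    have -> : u t - u s = (un n t - un n s) - (un n t - u t) + (un n s - u s).
      set a := un n t; set c := un n s; set x := u t; set y := u s.
      by rewrite opprB [a - c + _]addrC subrKA subrKA.
    have h1 : `|un n t - un n s| <= e / 3 by near: s.
    have h2 := le_trans (Hu t tT n) Hn.
    have h3 := le_trans (Hu s sT n) Hn.
    apply: le_trans (ler_normD _ _) _.
    have := ler_normB (un n t - un n s) (un n t - u t).
    lra.
  exists (`|x0| + D) => t tT.
  rewrite -(subrKC x0 (u t)); apply: le_trans (ler_normD _ _) _; rewrite lerD2l.
  by rewrite distrC; have := Hu t tT 0%N; rewrite expr0 divr1.
have uE (t : R) : `|t| < T -> u t = step u t.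
  move=> tT; apply/eqP; rewrite -subr_eq0 -normr_le0.
  apply: (@le_geometric_le0 _ _ (D + D * E)) => n.
  have h1 := Hu t tT n.+1.
  have h2 : `|step (un n) t - step u t| <= D / 2 ^+ n / 2 * expR (l * `|t|).
    apply: (contr (un n) u (D / 2 ^+ n)) => //; first by rewrite divr_ge0// exprn_ge0.
    move=> s sT; apply: le_trans (Hu s sT n) _.
    have /andP[e1 _] := expE s sT.
    by rewrite ler_peMr// divr_ge0// exprn_ge0.
  have /andP[_ e2] := expE t tT.
  have -> : u t - step u t = - (un n.+1 t - u t) + (step (un n) t - step u t).
    by rewrite opprB subrKA.
  apply: le_trans (ler_normD _ _) _; rewrite normrN mulrDl; apply: lerD.
    apply: le_trans h1 _; rewrite -/D exprS invfM mulrCA ler_piMl// ?divr_ge0 ?exprn_ge0//.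
    lra.
  apply: le_trans h2 _.
  have q0 : 0 <= D / 2 ^+ n by rewrite divr_ge0// exprn_ge0.
  rewrite [D * E / _]mulrAC; nra.
exists u; split; first by rewrite uE ?normr0// step0.
move=> t tT; apply: near_eq_is_derive (d_step u t gu tT).
near=> s; apply/esym/uE; near: s.
exact: near_norm_lt.
Unshelve. all: by end_near. Qed.

End Existence.

(** * Uniform estimates on compact convex sets *)

Section ConvexCompact.
Context {R : realType} {V W : normedModType R} (b : frame V) (bW : frame W).
Variables (U K : set V) (g : V -> W).
Hypotheses (oU : open U) (cK : compact K) (vK : cvx_set K) (KU : K `<=` U).

Lemma is_derive_segment (h : V -> W) x y (s : R) : differentiable h (x + s *: y) ->
  is_derive s 1 (fun s : R => h (x + s *: y)) ('d h (x + s *: y) y).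
Proof. by move=> dh; apply: (is_derive_line _ _ _ _ _).1; exact: diff_is_derive. Qed.

Lemma compact_diff_bound : is_Ck 1 U g ->
  exists2 M : R, 0 < M & forall z v, K z -> `|'d g z v| <= M * `|v|.
Proof.
move=> cg.
have /choice [m Hm] i : exists m : R, 0 < m /\ forall z, K z -> `|'d g z (fr_v b i)| <= m.
  have [z Kz|m m0 Hm] := @compact_bounded_on _ _ _ K (fun z => 'd g z (fr_v b i)) cK.
    exact: is_Ck_continuous (is_Ck_diff (fr_v b i) oU cg) (KU Kz).
  by exists m.
exists (1 + \sum_i fr_lip b i * m i).
  rewrite ltr_wpDr// sumr_ge0// => i _.
  by rewrite mulr_ge0// ltW ?fr_lip_gt0//; have [] := Hm i.
move=> z v Kz; rewrite (linear_frame b ('d g z)) mulrDl mul1r.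
apply: (@le_trans _ _ (\sum_i fr_lip b i * m i * `|v|)); last first.
  by rewrite -mulr_suml lerDr.
apply: le_trans (ler_norm_sum _ _ _) _; apply: ler_sum => i _.
rewrite normrZ mulrAC ler_pM// ?fr_lipP//.
by have [_] := Hm i; apply.
Qed.

Lemma compact_lipschitz : is_Ck 1 U g ->
  exists2 L : R, 0 < L & forall x y, K x -> K y -> `|g y - g x| <= L * `|y - x|.
Proof.
move=> cg; have [M M0 HM] := compact_diff_bound cg.
exists (kappa bW * M); first by rewrite mulr_gt0// kappa_gt0.
move=> x y Kx Ky.
have := @mean_value_ineq _ _ bW (fun s : R => g (x + s *: (y - x)))
  (fun s => 'd g (x + s *: (y - x)) (y - x)) (M * `|y - x|).
rewrite scale1r scale0r addr0 subrKC -mulrA; apply.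
  move=> s s01; apply: is_derive_segment.
  by have [dg _] := cg; apply: dg; apply: KU; exact: vK.
by move=> s s01; apply: HM; exact: vK.
Qed.

End ConvexCompact.

Section SecondOrder.
Context {R : realType} {V W : normedModType R} (b : frame V) (bW : frame W).
Variables (U K : set V) (g : V -> W).
Hypotheses (oU : open U) (cK : compact K) (vK : cvx_set K) (KU : K `<=` U).

(** Taylor's formula with a quadratic remainder, uniformly on [K]: the
    differential is Lipschitz on [K], so the mean value inequality applies to
    [g] minus its linearization at [x]. *)
Lemma compact_second_order : is_Ck 2 U g ->
  exists2 C : R, 0 < C & forall x y, K x -> K y ->
    `|g y - g x - 'd g x (y - x)| <= C * `|y - x| ^+ 2.
Proof.
move=> cg.
have /choice [m Hm] i : exists m : R, 0 < m /\ forall x z, K x -> K z ->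
    `|'d g z (fr_v b i) - 'd g x (fr_v b i)| <= m * `|z - x|.
  have [m m0 Hm] := compact_lipschitz b bW oU cK vK KU (is_Ck_diff (fr_v b i) oU cg).
  by exists m.
pose D := 1 + \sum_i fr_lip b i * m i.
have D0 : 0 < D.
  rewrite ltr_wpDr// sumr_ge0// => i _.
  by rewrite mulr_ge0// ltW ?fr_lip_gt0//; have [] := Hm i.
have HD x z v : K x -> K z -> `|'d g z v - 'd g x v| <= D * `|v| * `|z - x|.
  move=> Kx Kz; rewrite (linear_frame b ('d g z)) (linear_frame b ('d g x)) -sumrB.
  rewrite /D mulrDl mul1r mulrDl.
  apply: (@le_trans _ _ (\sum_i fr_lip b i * m i * `|v| * `|z - x|)); last first.
    by rewrite -!mulr_suml lerDr mulr_ge0.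
  apply: le_trans (ler_norm_sum _ _ _) _; apply: ler_sum => i _.
  rewrite -scalerBr normrZ.
  have -> : fr_lip b i * m i * `|v| * `|z - x| =
    fr_lip b i * `|v| * (m i * `|z - x|) by ring.
  by rewrite ler_pM ?fr_lipP//; have [_] := Hm i; apply.
exists (kappa bW * D); first by rewrite mulr_gt0// kappa_gt0.
move=> x y Kx Ky.
have := @mean_value_ineq _ _ bW
  (fun s : R => g (x + s *: (y - x)) - s *: 'd g x (y - x))
  (fun s => 'd g (x + s *: (y - x)) (y - x) - 'd g x (y - x)) (D * `|y - x| ^+ 2).
rewrite !scale1r !scale0r addr0 subr0 subrKC -mulrA addrAC; apply.
  move=> s s01; apply: is_deriveB.
    apply: is_derive_segment.
    by have [dg _] := cg; apply: dg; apply: KU; exact: vK.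
  exact: is_derive_scale_id.
move=> s s01; apply: le_trans (HD _ _ _ Kx (vK Kx Ky s01)) _.
rewrite -mulrA ler_pM2l// [x + _]addrC addrK normrZ.
have /andP[s0 s1] := s01; rewrite ger0_norm// expr2 ler_wpM2l// ler_piMl//.
Qed.

End SecondOrder.

(** * Flows and their continuity *)

(** In [flow_K] one compact convex set contains all orbits that start near [x],
    so that the constants of the preceding estimates are uniform in time and
    in the starting point. *)
Record is_flow {R : realType} {V : normedModType R} (U N : set V) (T : R)
    (Z : V -> V) (phi : R -> V -> V) : Prop := IsFlow {
  flow_T : 0 < T;
  flow_oU : open U;
  flow_oN : open N;
  flow0 : forall x, N x -> phi 0 x = x;
  flow_der : forall x (t : R), N x -> `|t| < T ->
    is_derive t 1 (phi^~ x) (Z (phi t x));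
  flow_K : forall x, N x -> exists K, [/\ compact K, cvx_set K, K `<=` U &
    \forall y \near x, forall t : R, `|t| < T -> K (phi t y)] }.

(** Its solutions are pairs formed by an orbit of [Z] and a solution of the
    variational equation along this orbit. *)
Definition tangent_field {R : realType} {V : normedModType R} (Z : V -> V)
  (p : V * V) : V * V := (Z p.1, 'd Z (p.1) (p.2)).

Section Flow.
Context {R : realType} {V : normedModType R} (b : frame V).
Variables (U N : set V) (T : R) (Z : V -> V) (phi : R -> V -> V).
Hypotheses (sZ : smooth_on U Z) (fl : is_flow U N T Z phi).

Let T0 := flow_T fl.
Let oU := flow_oU fl.
Let k0 := kappa_gt0 b.

Lemma flow_in x (t : R) : N x -> `|t| < T -> U (phi t x).
Proof.
by move=> Nx tT; have [K [_ _ KU /nbhs_singleton H]] := flow_K fl Nx; apply/KU/H.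
Qed.

Lemma solution_dist (K : set V) (L : R) (u w : R -> V) (t : R) : 0 <= L ->
  (forall x y, K x -> K y -> `|Z y - Z x| <= L * `|y - x|) ->
  (forall s : R, `|s| <= `|t| -> K (u s) /\ is_derive s 1 u (Z (u s))) ->
  (forall s : R, `|s| <= `|t| -> K (w s) /\ is_derive s 1 w (Z (w s))) ->
  `|u t - w t| <= 2 * `|u 0 - w 0| * expR (2 * kappa b * (L + 1) * `|t|).
Proof.
move=> L0 LK Hu Hw.
have := @gronwall _ _ b (u - w) (fun s => Z (u s) - Z (w s)) L 0 t L0 (lexx 0).
rewrite -![(_ - _) _]/(_ - _) addr0; apply.
  move=> s st; have [_ du] := Hu s st; have [_ dw] := Hw s st.
  exact: is_deriveB.
move=> s st; have [Ku du] := Hu s st; have [Kw dw] := Hw s st.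
by rewrite addr0; exact: LK.
Qed.

Lemma expR_mono_T (L t : R) : 0 <= L -> `|t| < T ->
  expR (2 * kappa b * (L + 1) * `|t|) <= expR (2 * kappa b * (L + 1) * T).
Proof.
move=> L0 tT; rewrite ler_expR ler_wpM2l ?(ltW tT)//.
by rewrite !mulr_ge0// ?(ltW k0)//; lra.
Qed.

Lemma flow_lipschitz x : N x -> exists2 E : R, 0 < E &
  \forall y \near x, forall t : R, `|t| < T -> `|phi t y - phi t x| <= E * `|y - x|.
Proof.
move=> Nx; have [K [cK vK KU nK]] := flow_K fl Nx.
have [L L0 HL] := compact_lipschitz b b oU cK vK KU (sZ 1).
exists (2 * expR (2 * kappa b * (L + 1) * T)); first by rewrite mulr_gt0// expR_gt0.
have Ny : \forall y \near x, N y by apply: open_nbhs_nbhs; split => //; exact: flow_oN fl.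
near=> y => t tT.
have Ky : forall s : R, `|s| < T -> K (phi s y) by near: y.
have Kx := nbhs_singleton nK.
have Ny' : N y by near: y.
have st (s : R) : `|s| <= `|t| -> `|s| < T by move=> /le_lt_trans; apply.
have := @solution_dist K L (phi^~ y) (phi^~ x) t (ltW L0) HL.
rewrite (flow0 fl Nx) (flow0 fl Ny') => H; apply: le_trans (H _ _) _.
- by move=> s /st sT; split; [exact: Ky|exact: (flow_der fl Ny' sT)].
- by move=> s /st sT; split; [exact: Kx|exact: (flow_der fl Nx sT)].
- by rewrite mulrAC ler_wpM2r// ler_wpM2l// expR_mono_T// ltW.
Unshelve. all: by end_near. Qed.

Lemma flow_continuous_t x (t : R) : N x -> `|t| < T -> {for t, continuous (phi^~ x)}.
Proof.
move=> Nx tT; apply: differentiable_continuous; apply/derivable1_diffP.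
by have [] := flow_der fl Nx tT.
Qed.

(** Lipschitz dependence on the starting point, uniform in time, combined with
    continuity along a single orbit. *)
Lemma flow_continuous x (t : R) : N x -> `|t| < T ->
  {for (t, x), continuous (fun p => phi p.1 p.2)}.
Proof.
move=> Nx tT; have [E E0 HE] := flow_lipschitz Nx.
apply/cvgrPdist_le => /= e e0.
have e2 : 0 < e / 2 by rewrite divr_gt0.
have h1 : \forall s \near t, `|s| < T /\ `|phi t x - phi s x| <= e / 2.
  apply: filterI; first exact: near_norm_lt.
  by move/cvgrPdist_le: (flow_continuous_t Nx tT) => /(_ _ e2).
have h2 : \forall y \near x, (forall t : R, `|t| < T -> `|phi t y - phi t x| <= E * `|y - x|)
    /\ `|x - y| <= e / 2 / E.
  apply: filterI => //.
  have /cvgrPdist_le : (id @ x --> x) by exact: cvg_id.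
  by apply; rewrite divr_gt0.
exists ([set s : R | `|s| < T /\ `|phi t x - phi s x| <= e / 2],
  [set y | (forall t : R, `|t| < T -> `|phi t y - phi t x| <= E * `|y - x|)
    /\ `|x - y| <= e / 2 / E]); first by split.
move=> [s y] /= [[sT hs] [hy yE]].
rewrite -(subrKA (phi s x)); apply: le_trans (ler_normD _ _) _.
rewrite [leRHS](splitr e) lerD// distrC; apply: le_trans (hy s sT) _.
by rewrite -ler_pdivlMl// mulrC distrC.
Qed.

End Flow.

(** * The flow of the tangent field *)

Section CkDiffApply.
Context {R : realType} {V W X : normedModType R} (b : frame W).

Lemma is_Ck_diff_apply k (U : set V) (U' : set W) (g : W -> X) (f v : V -> W) :
  open U -> open U' -> (forall x, U x -> U' (f x)) ->
  is_Ck k.+1 U' g -> is_Ck k U f -> is_Ck k U v ->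
  is_Ck k U (fun x => 'd g (f x) (v x)).
Proof.
move=> oU oU' fU cg cf cv; apply: (is_Ck_diff_app b oU oU' _ cg fU cv) => h ch.
exact: (is_Ck_comp b oU oU' fU ch cf).
Qed.

End CkDiffApply.

Section ProductSets.
Context {R : realType} {V W : normedModType R}.

Lemma fst_continuous : continuous (fst : V * W -> V).
Proof. by move=> p; exact: cvg_fst. Qed.

Lemma snd_continuous : continuous (snd : V * W -> W).
Proof. by move=> p; exact: cvg_snd. Qed.

Lemma open_fst (U : set V) : open U -> open [set p : V * W | U p.1].
Proof. by move=> oU; apply: open_comp => // p _; exact: fst_continuous. Qed.

Lemma open_snd (U : set W) : open U -> open [set p : V * W | U p.2].
Proof. by move=> oU; apply: open_comp => // p _; exact: snd_continuous. Qed.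

Lemma cvx_setX (K : set V) (K' : set W) : cvx_set K -> cvx_set K' ->
  cvx_set (K `*` K').
Proof.
by move=> vK vK' [x y] [x' y'] s [/= ? ?] [/= ? ?] s01; split; [exact: vK|exact: vK'].
Qed.

Lemma is_derive_pair (f : R -> V) (g : R -> W) (t : R) d d' :
  is_derive t 1 f d -> is_derive t 1 g d' ->
  is_derive t 1 (fun s => (f s, g s)) (d, d').
Proof.
move=> /is_deriveP Hf /is_deriveP Hg; apply/is_deriveP => e e0.
have [r r0 Hr] := Hf e e0; have [r' r'0 Hr'] := Hg e e0.
exists (Num.min r r'); first by rewrite lt_min r0.
move=> h; rewrite lt_min => /andP[hr hr'].
by rewrite prod_normE ge_max Hr// Hr'.
Qed.

End ProductSets.

Section Tangent.
Context {R : realType} {V : normedModType R} (b : frame V).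
Variables (U N : set V) (T : R) (Z : V -> V) (phi : R -> V -> V).
Hypotheses (sZ : smooth_on U Z) (fl : is_flow U N T Z phi).

Let T0 := flow_T fl.
Let oU := flow_oU fl.
Let k0 := kappa_gt0 b.

Lemma smooth_tangent_field :
  smooth_on [set p : V * V | U p.1] (tangent_field Z).
Proof.
move=> k; have oU' := open_fst (W := V) oU.
have cf : is_Ck k [set p : V * V | U p.1] (fst : V * V -> V).
  exact: (is_Ck_linear k oU' fst_continuous).
have cs : is_Ck k [set p : V * V | U p.1] (snd : V * V -> V).
  exact: (is_Ck_linear k oU' snd_continuous).
apply: is_Ck_pair => //; first exact: (is_Ck_comp b oU' oU _ (sZ k) cf).
exact: (is_Ck_diff_apply b oU' oU _ (sZ k.+1) cf cs).
Qed.

(** The variational equation is linear, with bounded coefficients along an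
    orbit that stays in [K]. *)
Lemma linear_growth (K : set V) (M : R) (u : R -> V) (c : R -> V) (t : R) :
  0 <= M -> (forall z v, K z -> `|'d Z z v| <= M * `|v|) ->
  (forall s : R, `|s| <= `|t| -> K (c s) /\ is_derive s 1 u ('d Z (c s) (u s))) ->
  `|u t| <= 2 * `|u 0| * expR (2 * kappa b * (M + 1) * `|t|).
Proof.
move=> M0 HM Hu.
have := @gronwall _ _ b u (fun s => 'd Z (c s) (u s)) M 0 t M0 (lexx 0).
rewrite addr0; apply => s /Hu[Kc du] //.
by rewrite addr0; exact: HM.
Qed.

(** A linear equation is solvable as long as its coefficients are defined, so
    the flow of the tangent field lives for the same time [T]; this is what
    allows the induction in [flow_Ck]. By [linear_growth] the second component
    stays in a box, which provides the compact set of [flow_K]. *)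
Lemma tangent_flow_exists : exists psi : R -> V -> V -> V,
  is_flow [set p : V * V | U p.1] [set p : V * V | N p.1] T (tangent_field Z)
    (fun t p => (phi t p.1, psi t p.1 p.2)).
Proof.
have ex (p : V * V) : exists u : R -> V, N p.1 -> u 0 = p.2 /\
    forall t : R, `|t| < T -> is_derive t 1 u ('d Z (phi t p.1) (u t)).
  have [Nx|nN] := pselect (N p.1); last by exists (cst 0).
  have [K [cK vK KU /nbhs_singleton Kx]] := flow_K fl Nx.
  have [M M0 HM] := compact_diff_bound b oU cK KU (sZ 1).
  have flip (t : R) (x y : V) : `|t| < T ->
      `|'d Z (phi t p.1) x - 'd Z (phi t p.1) y| <= M * `|x - y|.
    by move=> tT; rewrite -linearB; exact: HM (Kx t tT).
  have fcont (u : R -> V) : (forall t : R, `|t| < T -> {for t, continuous u}) ->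
      forall t : R, `|t| < T -> {for t, continuous (fun s => 'd Z (phi s p.1) (u s))}.
    move=> cu; apply: (@is_Ck_diff_apply _ _ _ _ b 0 [set t : R | `|t| < T] U Z (phi^~ p.1) u) => //.
    + exact: open_norm_lt.
    + by move=> s sT; exact: (flow_in fl).
    + by move=> s sT; exact: (flow_continuous_t fl).
  have [u Hu] := @ode_exists _ _ b (fun t w => 'd Z (phi t p.1) w) T M (M * `|p.2|) p.2
     T0 (ltW M0) flip fcont (fun t tT => HM _ _ (Kx t tT)).
  by exists u.
have [psi Hpsi] := choice ex.
exists (fun t x v => psi (x, v) t); split => //.
- exact: open_fst.
- exact: open_fst (flow_oN fl).
- by move=> [x v] Nx /=; rewrite (flow0 fl Nx) (Hpsi (x, v) Nx).1.
- move=> [x v] t Nx tT /=.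
  by apply: is_derive_pair; [exact: (flow_der fl Nx tT)|exact: (Hpsi (x, v) Nx).2].
- move=> [x v] /= Nx; have [K [cK vK KU nK]] := flow_K fl Nx.
  have [M M0 HM] := compact_diff_bound b oU cK KU (sZ 1).
  pose B := 2 * (`|v| + 1) * expR (2 * kappa b * (M + 1) * T).
  pose r := \sum_i fr_lip b i * B.
  have B0 : 0 <= B by rewrite mulr_ge0 ?expR_ge0// mulr_ge0// addr_ge0.
  exists (K `*` box b 0 r); split.
  + by apply: compact_setX => //; exact: box_compact.
  + by apply: cvx_setX => //; exact: box_convex.
  + by move=> [y w] [/= /KU].
  + have Ny : \forall y \near x, N y by apply: open_nbhs_nbhs; split => //; exact: flow_oN fl.
    have nw : \forall w \near v, `|w| <= `|v| + 1.
      have /cvgrPdist_le/(_ _ ltr01) : (id @ v --> v) by exact: cvg_id.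
      apply: filterS => w vw; rewrite -(subrKC v w).
      by apply: le_trans (ler_normD _ _) _; rewrite lerD2l distrC.
    exists ([set y | N y /\ forall t : R, `|t| < T -> K (phi t y)], [set w | `|w| <= `|v| + 1]).
      by split => //=; apply: filterI.
    move=> [y w] /= [[Ny' Ky] wv] t tT; split => /=; first exact: Ky.
    apply: box_pointP => i; rewrite subr0.
    apply: le_trans (fr_lipP _ _ _) _.
    apply: (@le_trans _ _ (fr_lip b i * B)).
      rewrite ler_pM2l ?fr_lip_gt0//.
      apply: le_trans (@linear_growth K M (psi (y, w)) (phi^~ y) t (ltW M0) HM _) _.
        move=> s st; have sT := le_lt_trans st tT; split; first exact: Ky.
        exact: (Hpsi (y, w) Ny').2.
      rewrite (Hpsi (y, w) Ny').1 /B ler_pM ?mulr_ge0 ?expR_ge0//.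
        by rewrite ler_wpM2l.
      exact: (expR_mono_T b (ltW M0)).
    rewrite /r (bigD1 i)//= lerDl sumr_ge0// => j _.
    by rewrite mulr_ge0// ltW// fr_lip_gt0.
Qed.

Variable psi : R -> V -> V -> V.
Hypothesis tfl : is_flow [set p : V * V | U p.1] [set p : V * V | N p.1] T
  (tangent_field Z) (fun t p => (phi t p.1, psi t p.1 p.2)).

Lemma tangent_flow0 x v : N x -> psi 0 x v = v.
Proof. by move=> Nx; have := @flow0 _ _ _ _ _ _ _ tfl (x, v) Nx => /= -[]. Qed.

Lemma tangent_flow_der x v (t : R) : N x -> `|t| < T ->
  is_derive t 1 (fun s => psi s x v) ('d Z (phi t x) (psi t x v)).
Proof.
move=> Nx tT; have H := @flow_der _ _ _ _ _ _ _ tfl (x, v) t Nx tT.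
exact: (@is_derive_lin _ _ _ _ (snd : {linear (V * V)%type -> V}) _ _ _ _ snd_continuous H).
Qed.

(** Uniqueness for the variational equation. It identifies derivatives of the
    flow without computing them. *)
Lemma tangent_flow_unique x v (w : R -> V) (t : R) : N x -> `|t| < T -> w 0 = v ->
  (forall s : R, `|s| <= `|t| -> is_derive s 1 w ('d Z (phi s x) (w s))) ->
  w t = psi t x v.
Proof.
move=> Nx tT w0 dw.
have [K [cK vK KU /nbhs_singleton Kx]] := flow_K fl Nx.
have [M M0 HM] := compact_diff_bound b oU cK KU (sZ 1).
have := @linear_growth K M (fun s => w s - psi s x v) (phi^~ x) t (ltW M0) HM.
rewrite w0 tangent_flow0// subrr normr0 mulr0 mul0r.
move=> H; apply/eqP; rewrite -subr_eq0 -normr_le0; apply: H => s st.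
have sT := le_lt_trans st tT; split; first exact: Kx.
rewrite linearB.
by apply: is_deriveB; [exact: dw|exact: tangent_flow_der].
Qed.

(** The error phi(x + h v) - phi(x) - h psi satisfies the variational equation
    up to a term of order h^2, by [compact_second_order] and Lipschitz
    dependence on the starting point. It vanishes at time 0, so by Gronwall's
    inequality it is itself of order h^2. *)
Lemma flow_derive x v (t : R) : N x -> `|t| < T ->
  is_derive x v (phi t) (psi t x v).
Proof.
move=> Nx tT; have [K [cK vK KU nK]] := flow_K fl Nx.
have [M M0 HM] := compact_diff_bound b oU cK KU (sZ 1).
have [C C0 HC] := compact_second_order b b oU cK vK KU (sZ 2).
have [E E0 HE] := flow_lipschitz b sZ fl Nx.
have Ny : \forall y \near x, N y by apply: open_nbhs_nbhs; split => //; exact: flow_oN fl.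
have /nbhs_ballP [r /= r0 Hr] : \forall y \near x, [/\ N y,
    forall t : R, `|t| < T -> K (phi t y) &
    forall t : R, `|t| < T -> `|phi t y - phi t x| <= E * `|y - x|].
  by near=> y; split; near: y.
have {}Hr y : `|y - x| < r -> [/\ N y,
    forall t : R, `|t| < T -> K (phi t y) &
    forall t : R, `|t| < T -> `|phi t y - phi t x| <= E * `|y - x|].
  by move=> yr; apply: Hr; rewrite -ball_normE /= distrC.
have Kx := nbhs_singleton nK.
pose G := expR (2 * kappa b * (M + 1) * T).
pose D := C * (E * `|v|) ^+ 2 * G.
have D0 : 0 <= D by rewrite /D !mulr_ge0 ?exprn_ge0 ?expR_ge0 ?mulr_ge0// ltW.
have D1 : 0 < D + 1 by rewrite ltr_wpDl.
have v1 : 0 < `|v| + 1 by rewrite ltr_wpDl.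
apply/is_deriveP => eps eps0.
exists (Num.min (r / (`|v| + 1)) (eps / (D + 1))).
  by rewrite lt_min !divr_gt0.
move=> h; rewrite lt_min !ltr_pdivlMr// => /andP[hr he].
have hv : `|x + h *: v - x| < r.
  rewrite [x + _]addrC addrK normrZ; apply: le_lt_trans hr; rewrite ler_wpM2l//; lra.
have [Nh Kh Eh] := Hr _ hv.
have := @gronwall _ _ b
  (fun s => phi s (x + h *: v) - phi s x - h *: psi s x v)
  (fun s => Z (phi s (x + h *: v)) - Z (phi s x) - h *: 'd Z (phi s x) (psi s x v))
  M (C * (E * (`|h| * `|v|)) ^+ 2) t (ltW M0).
rewrite (flow0 fl Nx) (flow0 fl Nh) tangent_flow0// [x + _]addrC addrK subrr normr0 mulr0 add0r.
move=> H; apply: le_trans (H _ _ _) _.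
- by rewrite mulr_ge0 ?exprn_ge0 ?mulr_ge0// ltW.
- move=> s st; have sT := le_lt_trans st tT.
  apply: is_deriveB; last by apply: is_deriveZ; exact: tangent_flow_der.
  by apply: is_deriveB; rewrite ?[h *: v + x]addrC; [exact: (flow_der fl Nh sT)|exact: (flow_der fl Nx sT)].
- move=> s st; have sT := le_lt_trans st tT; rewrite [h *: v + x]addrC.
  set P := phi s (x + h *: v); set Q := phi s x; set S := psi s x v.
  have -> : Z P - Z Q - h *: 'd Z Q S =
      'd Z Q (P - Q - h *: S) + (Z P - Z Q - 'd Z Q (P - Q)).
    by rewrite [in RHS]linearB [in RHS]linearZ /= [RHS]addrC addrA subrK.
  apply: le_trans (ler_normD _ _) _; apply: lerD; first exact: HM (Kx s sT).
  apply: le_trans (HC _ _ (Kx s sT) (Kh s sT)) _.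
  rewrite ler_pM2l// ler_pXn2r// ?nnegrE ?mulr_ge0// ?(ltW E0)//.
  by apply: le_trans (Eh s sT) _; rewrite [x + _]addrC addrK normrZ.
- apply: (@le_trans _ _ (C * (E * (`|h| * `|v|)) ^+ 2 * G)).
    rewrite ler_wpM2l ?expR_mono_T// ?(ltW M0)//.
    by rewrite mulr_ge0 ?exprn_ge0 ?mulr_ge0// ltW.
  have -> : C * (E * (`|h| * `|v|)) ^+ 2 * G = `|h| * D * `|h| by rewrite /D; ring.
  rewrite ler_wpM2r//; apply: le_trans (ltW he); rewrite ler_wpM2l//; lra.
Unshelve. all: by end_near. Qed.

End Tangent.

(** * Smoothness of flows *)

Section CurveDerivatives.
Context {R : realType} {V W : normedModType R}.

Lemma is_derive_fst (F : R * V -> W) (t : R) (x : V) (d : W) :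
  is_derive t 1 (fun s => F (s, x)) d -> is_derive (t, x) (1, 0) F d.
Proof.
move=> /is_deriveP H; apply/is_deriveP => e e0; have [r r0 Hr] := H e e0.
exists r => // h hr; have -> : (t, x) + h *: (1, 0) = (t + h *: 1, x).
  by rewrite -[LHS]/(t + h *: 1, x + h *: 0) scaler0 addr0.
exact: Hr.
Qed.

Lemma is_derive_snd (F : R * V -> W) (t : R) (x v : V) (d : W) :
  is_derive x v (fun y => F (t, y)) d -> is_derive (t, x) (0, v) F d.
Proof.
move=> /is_deriveP H; apply/is_deriveP => e e0; have [r r0 Hr] := H e e0.
exists r => // h hr; have -> : (t, x) + h *: (0, v) = (t, x + h *: v).
  by rewrite -[LHS]/(t + h *: 0, x + h *: v) scaler0 addr0.
exact: Hr.
Qed.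

Lemma is_derive_shift_time (c : R -> V) (r s : R) (d : V) :
  is_derive (r + s) 1 c d -> is_derive r 1 (fun t => c (t + s)) d.
Proof.
move=> /is_deriveP H; apply/is_deriveP => e e0; have [q q0 Hq] := H e e0.
by exists q => // h hq; rewrite [r + _ + s]addrAC; exact: Hq.
Qed.

Lemma is_derive_chain (g : V -> W) (c : R -> V) (t : R) (d : V) :
  is_derive t 1 c d -> differentiable g (c t) ->
  is_derive t 1 (fun s => g (c s)) ('d g (c t) d).
Proof.
move=> [dc <-] dg; have /derivable1_diffP dc' := dc.
have := diff_is_derive (1 : R) (differentiable_comp dc' dg).
by rewrite (diff_comp dc' dg) /= -(deriveE _ dc').
Qed.

End CurveDerivatives.

Definition flow_dom {R : realType} {V : normedModType R} (T : R) (N : set V) :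
  set (R * V) := [set p | `|p.1| < T /\ N p.2].

Lemma open_flow_dom {R : realType} {V : normedModType R} (T : R) (N : set V) :
  open N -> open (flow_dom T N).
Proof.
move=> oN; have h1 := @open_fst R R V _ (@open_norm_lt R T).
by have h2 := @open_snd R R V _ oN; exact: (openI h1 h2).
Qed.

Section FlowSmooth.
Context {R : realType}.

(** Induction on [k], over all fields on all spaces at once. The partial
    derivative of the flow in time is [Z] along the flow; its partial
    derivatives in space are components of the flow of the tangent field. Both
    are C^k by the induction hypothesis, the latter on V * V. *)
Lemma flow_Ck k (V : normedModType R) (b : frame V) (U N : set V) (T : R)
    (Z : V -> V) (phi : R -> V -> V) :
  smooth_on U Z -> is_flow U N T Z phi ->
  is_Ck k (flow_dom T N) (fun p => phi p.1 p.2).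
Proof.
elim: k V b U N Z phi => [|k IH] V b U N Z phi sZ fl.
  by move=> [t x] [tT Nx]; exact: (flow_continuous b sZ fl).
have [psi tfl] := tangent_flow_exists b sZ fl.
have oD := @open_flow_dom _ _ T _ (flow_oN fl).
have Ckphi := IH V b U N Z phi sZ fl.
have Ckpsi := IH _ (frame_prod b b) _ _ _ _ (smooth_tangent_field b sZ fl) tfl.
have oD2 := @open_flow_dom _ _ T _ (flow_oN tfl).
pose d (i : 'I_(fr_n (frame_prod frame_R b))) (p : R * V) : V :=
  match fintype.split i with
  | inl _ => Z (phi p.1 p.2)
  | inr j => psi p.1 p.2 (fr_v b j)
  end.
have Hd p : flow_dom T N p -> forall i,
    is_derive p (fr_v (frame_prod frame_R b) i) (fun p => phi p.1 p.2) (d i p).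
  case: p => t x [/= tT Nx] i; rewrite /d /= /frame_prod_v; case: fintype.split => j.
    exact: is_derive_fst (flow_der fl Nx tT).
  by apply: is_derive_snd; exact: (flow_derive b sZ fl tfl).
apply: (is_Ck_frame (b := frame_prod frame_R b) b oD).
  by move=> p Dp i; have [] := Hd p Dp i.
move=> i; apply: (is_Ck_ext (f := d i) oD).
  by move=> p Dp; have [_ ->] := Hd p Dp i.
rewrite /d; case: fintype.split => j.
  apply: (is_Ck_comp b oD (flow_oU fl) _ (sZ k) Ckphi).
  by move=> [t x] [/= tT Nx]; exact: (flow_in fl).
pose F (q : R * (V * V)) : V * V := (phi q.1 q.2.1, psi q.1 q.2.1 q.2.2).
have CF : is_Ck k (flow_dom T [set p : V * V | N p.1]) (snd \o F).
  exact: (is_Ck_lin oD2 snd_continuous Ckpsi).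
have := is_Ck_comp (frame_prod frame_R (frame_prod b b)) oD oD2 _ CF.
move=> /(_ (fun p : R * V => (p.1, (p.2, fr_v b j)))); apply => //.
apply: (is_Ck_pair oD); first exact: (is_Ck_linear k oD fst_continuous).
apply: (is_Ck_pair oD); first exact: (is_Ck_linear k oD snd_continuous).
exact: is_Ck_cst.
Qed.

End FlowSmooth.

(** * Local flows *)

(** The facts about a flow and its derivative [psi] in the starting point that
    the geometric part relies on. In [lf_group] the bound on the times keeps
    both sides inside the interval on which orbits are defined. *)
Record local_flow {R : realType} {V : normedModType R} (U N : set V) (T : R)
    (Z : V -> V) (phi : R -> V -> V) (psi : R -> V -> V -> V) : Prop := LocalFlow {
  lf_T : 0 < T;
  lf_open : open N;
  lf_smooth : smooth_on (flow_dom T N) (fun p => phi p.1 p.2);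
  lf_tangent_smooth : smooth_on (flow_dom T [set p : V * V | N p.1])
    (fun p => psi p.1 p.2.1 p.2.2);
  lf_0 : forall x, N x -> phi 0 x = x;
  lf_in : forall x (t : R), N x -> `|t| < T -> U (phi t x);
  lf_der : forall x (t : R), N x -> `|t| < T ->
    is_derive t 1 (phi^~ x) (Z (phi t x));
  lf_tangent_der : forall x v (t : R), N x -> `|t| < T ->
    is_derive t 1 (fun s => psi s x v) ('d Z (phi t x) (psi t x v));
  lf_diff : forall x v (t : R), N x -> `|t| < T -> is_derive x v (phi t) (psi t x v);
  lf_tangent_unique : forall x v (w : R -> V) (t : R), N x -> `|t| < T -> w 0 = v ->
    (forall s : R, `|s| <= `|t| -> is_derive s 1 w ('d Z (phi s x) (w s))) ->
    w t = psi t x v;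
  lf_group : forall x (s t : R), N x -> N (phi s x) -> `|s| + `|t| < T ->
    phi t (phi s x) = phi (t + s) x }.

Section LocalFlow.
Context {R : realType} {V : normedModType R} (b : frame V).
Variables (U : set V) (Z : V -> V) (x0 : V).
Hypotheses (oU : open U) (Ux0 : U x0) (sZ : smooth_on U Z).

(** The field is composed with the retraction onto a box around [x0], and time
    is bounded so that orbits starting near [x0] do not leave the part of the
    box where the retraction is the identity. *)
Lemma flow_exists : exists (N K : set V) (T : R) (phi : R -> V -> V),
  [/\ N x0, compact K, cvx_set K, K `<=` U & is_flow U N T Z phi /\
   forall x (t : R), N x -> `|t| < T -> K (phi t x)].
Proof.
have [r r0 rU] := box_sub b oU Ux0.
pose K := box b x0 r.
have cK : compact K by exact: box_compact.
have vK : cvx_set K by exact: box_convex.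
have [M M0 HM] : exists2 M : R, 0 < M & forall x, K x -> `|Z x| <= M.
  by apply: compact_bounded_on => // x Kx; exact: is_Ck_continuous (sZ 0) (rU _ Kx).
have [L L0 HL] := compact_lipschitz b b oU cK vK rU (sZ 1).
have k0 := kappa_gt0 b.
have KR x : K (retract b x0 r x) by apply: retract_box; exact: ltW.
have r2 : 0 < r / 2 by rewrite divr_gt0.
pose Lam := 1 + \sum_i fr_lip b i.
have Lam0 : 0 < Lam by rewrite ltr_wpDr// sumr_ge0// => i _; rewrite ltW// fr_lip_gt0.
have LamP i : fr_lip b i <= Lam.
  rewrite /Lam (bigD1 i)//= addrCA lerDl addr_ge0// sumr_ge0// => j _.
  by rewrite ltW// fr_lip_gt0.
(* At speed [M] a coordinate moves by at most r / 2 within time [T]; the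
   starting points below have coordinates bounded by the other r / 2. *)
pose T := r / 2 / (Lam * (kappa b * M)).
have T0 : 0 < T by rewrite !divr_gt0// !mulr_gt0.
have /nbhs_ballP [rho /= rho0 Hrho] := box_nbhs b x0 r2.
have lipf (t : R) x y : `|t| < T ->
    `|Z (retract b x0 r x) - Z (retract b x0 r y)| <= L * kappa b * `|x - y|.
  move=> _; apply: le_trans (HL _ _ (KR y) (KR x)) _.
  by rewrite -mulrA ler_pM2l// retract_lip// ltW.
have contf (u : R -> V) : (forall t : R, `|t| < T -> {for t, continuous u}) ->
    forall t : R, `|t| < T -> {for t, continuous (fun s => Z (retract b x0 r (u s)))}.
  move=> cu t tT; apply/cvgrPdist_le => e e0.
  have Lk : 0 < L * kappa b by rewrite mulr_gt0.
  have /cvgrPdist_le/(_ (e / (L * kappa b))) := cu t tT.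
  rewrite divr_gt0// => /(_ isT); apply: filterS => s us.
  apply: le_trans (lipf 0 _ _ _) _; first by rewrite normr0.
  by rewrite -ler_pdivlMl// mulrC.
have ex (x : V) : exists u : R -> V, u 0 = x /\
    forall t : R, `|t| < T -> is_derive t 1 u (Z (retract b x0 r (u t))).
  apply: (@ode_exists _ _ b (fun _ w => Z (retract b x0 r w)) T (L * kappa b) M x T0 _ lipf contf).
    by rewrite mulr_ge0// ltW.
  by move=> t _; exact: HM.
have [phi Hphi] := choice ex.
have phiK x (t : R) : ball x0 rho x -> `|t| < T -> forall i, `|fr_c b i (phi x t - x0)| <= r.
  move=> /Hrho Nx tT i.
  have h1 : `|phi x t - phi x 0| <= kappa b * M * `|t|.
    apply: (@growth_cst _ _ b (phi x) (fun s => Z (retract b x0 r (phi x s)))) => s st.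
      by apply: (Hphi x).2; exact: le_lt_trans st tT.
    exact: HM.
  rewrite -(subrKA (phi x 0)) linearD; apply: le_trans (ler_normD _ _) _.
  rewrite [leRHS](splitr r) lerD//; last by rewrite (Hphi x).1; exact: Nx.
  apply: le_trans (fr_lipP _ _ _) _.
  apply: (@le_trans _ _ (Lam * (kappa b * M * `|t|))).
    by rewrite ler_pM// ltW// fr_lip_gt0.
  have := ltW tT; rewrite /T ler_pdivlMr ?mulr_gt0// => h2.
  by rewrite mulrA mulrC.
exists (ball x0 rho), K, T, (fun t x => phi x t); split => //; first exact: ballxx.
split; last by move=> x t Nx tT; apply: box_pointP; exact: phiK.
split => //.
- exact: ball_open.
- by move=> x _; exact: (Hphi x).1.
- move=> x t Nx tT; have := (Hphi x).2 t tT.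
  by rewrite retract_id//; exact: phiK.
- move=> x Nx; exists K; split => //.
  have : \forall y \near x, ball x0 rho y.
    by apply: open_nbhs_nbhs; split => //; exact: ball_open.
  by apply: filterS => y Ny t tT; apply: box_pointP; exact: phiK.
Qed.

Theorem local_flow_exists : exists (N : set V) (T : R) phi psi,
  N x0 /\ local_flow U N T Z phi psi.
Proof.
have [N [K [T [phi [Nx0 cK vK KU [fl phiK]]]]]] := flow_exists.
have [psi tfl] := tangent_flow_exists b sZ fl.
exists N, T, phi, psi; split => //; split.
- exact: flow_T fl.
- exact: flow_oN fl.
- by move=> k; exact: (flow_Ck k b sZ fl).
- move=> k.
  have := flow_Ck k (frame_prod b b) (smooth_tangent_field b sZ fl) tfl.
  move=> H; apply: (is_Ck_lin (l := snd) _ snd_continuous H).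
  exact: open_flow_dom (flow_oN tfl).
- exact: flow0 fl.
- exact: flow_in fl.
- exact: flow_der fl.
- exact: (tangent_flow_der tfl).
- exact: (flow_derive b sZ fl tfl).
- exact: (tangent_flow_unique b sZ fl tfl).
- move=> x s t Nx Ns st.
  have [L L0 HL] := compact_lipschitz b b oU cK vK KU (sZ 1).
  have rT (r : R) : `|r| <= `|t| -> `|r| < T /\ `|r + s| < T.
    move=> rt; have := ler_normD r s; have := normr_ge0 s; have := normr_ge0 r.
    by split; lra.
  have := @solution_dist _ _ b Z K L (phi^~ (phi s x)) (fun r => phi (r + s) x) t (ltW L0) HL.
  rewrite (flow0 fl Ns) add0r subrr normr0 mulr0 mul0r.
  move=> H; apply/eqP; rewrite -subr_eq0 -normr_le0; apply: H => r /rT[rT1 rT2].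
    by split; [exact: phiK|exact: (flow_der fl)].
  split; first exact: phiK.
  by apply: (@is_derive_shift_time _ _ (phi^~ x)); exact: (flow_der fl).
Qed.

End LocalFlow.

(** * Symmetry of second derivatives *)

Section Schwarz.
Context {R : realType} {V W : normedModType R} (bW : frame W).
Variables (U : set V) (f : V -> W).
Hypotheses (oU : open U) (cf : is_Ck 2 U f).

(** Two applications of the mean value inequality, first in the direction [u]
    and then in the direction [v]. *)
Lemma second_difference x u v (e : R) : U x -> 0 < e -> exists2 r : R, 0 < r &
  forall h : R, `|h| < r ->
   `|f (x + h *: u + h *: v) - f (x + h *: u) - (f (x + h *: v) - f x)
      - h ^+ 2 *: 'D_v ('D_u f) x| <= kappa bW * (kappa bW * e) * h ^+ 2.
Proof.
move=> Ux e0; have [df cDf] := cf; have [dDf cDDf] := cDf u.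
have k0 := kappa_gt0 bW.
set c := 'D_v ('D_u f) x.
have : \forall y \near x, U y /\ `|'D_v ('D_u f) y - c| <= e.
  apply: filterI; first exact: open_nbhs_nbhs.
  have /cvgrPdist_le/(_ _ e0) Hc := cDDf v x Ux.
  near=> y; rewrite distrC; near: y; exact: Hc.
move=> /nbhs_ballP [r /= r0 Hr].
have {}Hr y : `|y - x| < r -> U y /\ `|'D_v ('D_u f) y - c| <= e.
  by move=> yx; apply: Hr; rewrite -ball_normE /= distrC.
have B0 : 0 < 1 + `|u| + `|v| by rewrite -addrA ltr_wpDr// addr_ge0.
exists (r / (1 + `|u| + `|v|)); first exact: divr_gt0.
move=> h; rewrite ltr_pdivlMr// => hr.
have near_x (s q : R) : 0 <= s <= 1 -> 0 <= q <= 1 ->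
    `|x + s *: (h *: u) + q *: (h *: v) - x| < r.
  move=> /andP[s0 s1] /andP[q0 q1]; rewrite -(addrA x) [x + _]addrC addrK.
  apply: le_lt_trans (ler_normD _ _) _; rewrite !normrZ (ger0_norm s0) (ger0_norm q0).
  apply: le_lt_trans hr; have := normr_ge0 h.
  have hu : s * (`|h| * `|u|) <= `|h| * `|u| by rewrite ler_piMl// mulr_ge0.
  have hv : q * (`|h| * `|v|) <= `|h| * `|v| by rewrite ler_piMl// mulr_ge0.
  lra.
have p01 : 0 <= (1 : R) <= 1 by rewrite ler01 lexx.
have p00 : 0 <= (0 : R) <= 1 by rewrite ler01 lexx.
have inner_diff (s : R) : 0 <= s <= 1 ->
    `|'D_u f (x + s *: (h *: u) + h *: v) - 'D_u f (x + s *: (h *: u)) - h *: c|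
      <= kappa bW * (`|h| * e).
  move=> s01; have := @mean_value_ineq _ _ bW
    (fun q : R => 'D_u f (x + s *: (h *: u) + q *: (h *: v)) - q *: (h *: c))
    (fun q => h *: 'D_v ('D_u f) (x + s *: (h *: u) + q *: (h *: v)) - h *: c) (`|h| * e).
  rewrite !scale1r !scale0r addr0 subr0 addrAC; apply.
    move=> q q01; have [Uy _] := Hr _ (near_x s q s01 q01).
    apply: is_deriveB.
      apply: (is_derive_line ('D_u f) (x + s *: (h *: u)) (h *: v) _ q).1.
      by apply: is_deriveZv; apply: derivableP; apply: diff_derivable; exact: dDf.
    exact: is_derive_scale_id.
  move=> q q01; have [_ Hy] := Hr _ (near_x s q s01 q01).
  by rewrite -scalerBr normrZ ler_wpM2l.
have := @mean_value_ineq _ _ bW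
  (fun s : R => f (x + s *: (h *: u) + h *: v) - f (x + s *: (h *: u)) - s *: (h ^+ 2 *: c))
  (fun s => h *: 'D_u f (x + s *: (h *: u) + h *: v) - h *: 'D_u f (x + s *: (h *: u)) - h ^+ 2 *: c)
  (kappa bW * e * h ^+ 2).
rewrite !scale1r !scale0r addr0 subr0 => H.
have -> : f (x + h *: u + h *: v) - f (x + h *: u) - (f (x + h *: v) - f x) - h ^+ 2 *: c =
  f (x + h *: u + h *: v) - f (x + h *: u) - h ^+ 2 *: c - (f (x + h *: v) - f x).
  by rewrite addrAC.
rewrite -[leRHS]mulrA; apply: H.
- move=> s s01; have [U1 _] := Hr _ (near_x s 1 s01 p01).
  have [U0 _] := Hr _ (near_x s 0 s01 p00).
  rewrite scale1r in U1; rewrite scale0r addr0 in U0.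
  apply: is_deriveB; last exact: is_derive_scale_id.
  apply: is_deriveB.
    have dU1 : is_derive (x + h *: v + s *: (h *: u)) (h *: u) f
        (h *: 'D_u f (x + s *: (h *: u) + h *: v)).
      rewrite addrAC; apply: is_deriveZv.
      by apply: derivableP; apply: diff_derivable; exact: df.
    have := (is_derive_line _ _ _ _ _).1 dU1.
    by under eq_fun do rewrite addrAC.
  apply: (is_derive_line f x (h *: u) _ s).1.
  by apply: is_deriveZv; apply: derivableP; apply: diff_derivable; exact: df.
- move=> s s01; rewrite -scalerBr expr2 -scalerA -scalerBr normrZ.
  have := inner_diff s s01 => Hi.
  apply: (@le_trans _ _ (`|h| * (kappa bW * (`|h| * e)))); first by rewrite ler_wpM2l.
  by rewrite -[h * h]/(h ^+ 2) -(real_normK (num_real h)) expr2; lra.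
Unshelve. all: by end_near. Qed.

(** The second difference is symmetric in [u] and [v], and [second_difference]
    compares it with either mixed derivative. *)
Lemma schwarz x u v : U x -> 'D_v ('D_u f) x = 'D_u ('D_v f) x.
Proof.
move=> Ux; apply/eqP; rewrite -subr_eq0 -normr_le0.
have k0 := kappa_gt0 bW; set K := kappa bW * kappa bW.
have K0 : 0 < K by rewrite mulr_gt0.
apply/ler_addgt0Pr => e e0; rewrite add0r.
have e1 : 0 < e / (2 * K) by rewrite divr_gt0// mulr_gt0.
have [r r0 Hr] := second_difference u v Ux e1.
have [q q0 Hq] := second_difference v u Ux e1.
pose h := Num.min r q / 2.
have h0 : 0 < h by rewrite divr_gt0// lt_min r0.
have hm : h < Num.min r q.
  rewrite /h ltr_pdivrMr//; have : 0 < Num.min r q by rewrite lt_min r0.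
  lra.
have := hm; rewrite lt_min => /andP[hr hq].
have := Hr h; have := Hq h; rewrite (gtr0_norm h0) => /(_ hq) H1 /(_ hr) H2.
have h2 : 0 < h ^+ 2 by rewrite exprn_gt0.
rewrite -(ler_pM2l h2) -{1}(gtr0_norm h2) -normrZ scalerBr.
set P := f (x + h *: u + h *: v) in H2 *; set A := f (x + h *: u) in H1 H2.
have PE : f (x + h *: v + h *: u) = P by rewrite addrAC.
rewrite PE in H1; set B := f (x + h *: v) in H1 H2.
set a := h ^+ 2 *: _ in H2 *; set c := h ^+ 2 *: _ in H1 *.
have -> : a - c = (P - B - (A - f x) - c) - (P - A - (B - f x) - a).
  have -> : P - B - (A - f x) = P - A - (B - f x).
    by rewrite !opprB [LHS]addrACA [in LHS](addrC (- B)) -addrACA.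
  by rewrite [- (_ - a)]opprB [RHS]addrC subrKA.
apply: le_trans (ler_normB _ _) _; apply: le_trans (lerD H1 H2) _.
have -> : kappa bW * (kappa bW * (e / (2 * K))) = e / 2.
  by rewrite /K; field; rewrite gt_eqF.
by rewrite -mulrDl -splitr mulrC.
Qed.

End Schwarz.

(** * The Jacobi identity for commuting fields *)

Section SecondDerivatives.
Context {R : realType} {V : normedModType R} (b : frame V).
Variables (U : set V) (oU : open U).
Local Notation e := (fr_v b).

(** The derivative in the direction [w] of the differential of [A] applied to
    the constant field [v], expanded in the frame. *)
Definition hessian (A : V -> R) (z w v : V) : R :=
  \sum_i fr_c b i v * (\sum_j fr_c b j w * 'D_(e j) ('D_(e i) A) z).

Lemma hessian_sym (A : V -> R) z w v : is_Ck 2 U A -> U z ->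
  hessian A z w v = hessian A z v w.
Proof.
move=> cA Uz; rewrite /hessian.
under eq_bigr do rewrite mulr_sumr.
rewrite exchange_big /=; apply: eq_bigr => i _.
rewrite mulr_sumr; apply: eq_bigr => j _.
rewrite mulrCA (schwarz frame_R oU cA) //.
Qed.

(** Leibniz rule for a differential applied to a moving vector: one term for
    the motion of [X], and one for the second derivative of [A]. *)
Lemma diff_along (A : V -> R) (X : V -> V) z w : is_Ck 2 U A -> is_Ck 1 U X -> U z ->
  differentiable (fun z => 'd A z (X z)) z /\
  'd (fun z => 'd A z (X z)) z w = 'd A z ('d X z w) + hessian A z w (X z).
Proof.
move=> cA cX Uz; have [dA cDA] := cA; have [dX _] := cX.
have cd : is_Ck 1 U (fun z => 'd A z (X z)).
  exact: (is_Ck_diff_apply b oU oU (fun _ => id) cA (is_Ck_id 1 oU) cX).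
have [dd _] := cd; split; first exact: dd.
rewrite -(deriveE _ (dd z Uz)).
have -> : 'D_w (fun z => 'd A z (X z)) z =
    'D_w (\sum_i (fun z => fr_c b i (X z) *: 'D_(e i) A z)) z.
  apply: (derive_ext _ oU _ Uz) => y Uy.
  rewrite fct_sumE (linear_frame b ('d A y)); apply: eq_bigr => i _.
  by rewrite deriveE//; exact: dA.
have Hd i : is_derive z w (fun z => fr_c b i (X z) *: 'D_(e i) A z)
   (fr_c b i (X z) *: 'd ('D_(e i) A) z w + fr_c b i ('d X z w) *: 'D_(e i) A z).
  have dDA : differentiable ('D_(e i) A) z by have [d _] := cDA (e i); exact: d.
  have dcX : differentiable (fr_c b i \o X) z.
    by apply: differentiable_comp; [exact: dX|apply: linear_differentiable; exact: fr_cont].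
  have [ds E] := diff_scale dcX dDA.
  apply: (is_derive_eq (diff_is_derive w ds)); rewrite E; congr (_ + _ *: _).
  rewrite diff_comp; [|exact: dX|apply: linear_differentiable; exact: fr_cont].
  by rewrite /= diff_lin//; exact: fr_cont.
have [_ ->] := is_derive_sum Hd.
rewrite big_split /= addrC; congr (_ + _).
  rewrite (linear_frame b ('d A z)); apply: eq_bigr => i _.
  by rewrite deriveE//; exact: dA.
apply: eq_bigr => i _; congr (_ * _).
by rewrite (linear_frame b ('d ('D_(e i) A) z)); apply: eq_bigr => j _;
  rewrite deriveE//; have [d _] := cDA (e i); exact: d.
Qed.

End SecondDerivatives.

Lemma diff_mul_sub {R : realType} (V : normedModType R) (p q r s : V -> R) z w :
  differentiable p z -> differentiable q z -> differentiable r z -> differentiable s z ->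
  'd (fun z => p z * q z - r z * s z) z w =
    ('d p z w * q z + p z * 'd q z w) - ('d r z w * s z + r z * 'd s z w).
Proof.
move=> dp dq dr ds.
have M (f g : V -> R) : differentiable f z -> differentiable g z ->
    is_derive z w (f * g) ('d f z w * g z + f z * 'd g z w).
  move=> /(diff_is_derive w) Df /(diff_is_derive w) Dg.
  have D := is_deriveM Df Dg; apply: (is_derive_eq D).
  by rewrite addrC; congr (_ + _); rewrite -[LHS]/(_ * _) mulrC.
have [_ D] := is_deriveB (M p q dp dq) (M r s dr ds).
rewrite -deriveE; first exact: D.
by apply: differentiableB; exact: differentiableM.
Qed.

(** Kept as a named derivation so that the Jacobi sum is an identity between
    iterated derivations. *)
Definition along {R : realType} {V : normedModType R} (X : V -> V) (A : V -> R) :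
  V -> R := fun z => 'd A z (X z).

Section Jacobi.
Context {R : realType} {H : innerProductType R}.
Implicit Types u v : H.

Lemma innerBl u v w : inner (u - v) w = inner u w - inner v w.
Proof. by rewrite ![inner _ w]inner_sym linearB. Qed.

Lemma innerZl a u v : inner (a *: u) v = a * inner u v.
Proof. by rewrite ![inner _ v]inner_sym linearZ. Qed.

Lemma innerBr u v w : inner w (u - v) = inner w u - inner w v.
Proof. by rewrite linearB. Qed.

Lemma innerZr a u v : inner v (a *: u) = a * inner v u.
Proof. by rewrite linearZ. Qed.

Lemma skew_wedge (Y Z : H) : skew_symmetric_map (wedge Y Z).
Proof.
split=> [a u v|u v]; rewrite /wedge.
  by rewrite !(inner_linear _ a u v) !scalerDl scalerBr !scalerA opprD addrACA.
rewrite innerBl !innerZl innerBr !innerZr.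
rewrite [inner u Z]inner_sym [inner u Y]inner_sym; ring.
Qed.

(** Gradients pair with vectors as differentials do, so the bracket does not
    involve the inner product. *)
Lemma poisson_bracket_wedge (Y Z : H -> H) (A B : H -> R) :
  poisson_bracket (fun z => wedge (Y z) (Z z)) A B =
  (fun z => along Y B z * along Z A z - along Z B z * along Y A z).
Proof.
apply/funext => z; rewrite /poisson_bracket /wedge innerBr !innerZr !gradE.
by rewrite [inner (Y z) _]inner_sym [inner (Z z) _]inner_sym !gradE.
Qed.

Variables (W : set H) (Y Z : H -> H).
Hypotheses (oW : open W) (sY : smooth_on W Y) (sZ : smooth_on W Z).
Hypothesis YZ0 : forall z, W z -> lie_bracket Y Z z = 0.

(** The Hessian terms agree by symmetry, and the first order terms differ by
    the Lie bracket of [Y] and [Z]. *)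
Lemma along_commute (A : H -> R) z : smooth_on W A -> W z ->
  along Z (along Y A) z = along Y (along Z A) z.
Proof.
move=> sA Wz.
have [_ EY] := diff_along frame_H oW (Z z) (sA 2) (sY 1) Wz.
have [_ EZ] := diff_along frame_H oW (Y z) (sA 2) (sZ 1) Wz.
apply: (etrans EY); apply: (etrans _ (esym EZ)).
rewrite (hessian_sym frame_H oW _ _ (sA 2) Wz); congr ('d A z _ + _).
by apply/eqP; rewrite eq_sym -subr_eq0; apply/eqP; exact: YZ0.
Qed.

Lemma along_bracket (A B : H -> R) (X : H -> H) z : smooth_on W A -> smooth_on W B ->
  W z ->
  along X (fun z => along Y B z * along Z A z - along Z B z * along Y A z) z =
    (along X (along Y B) z * along Z A z + along Y B z * along X (along Z A) z)
  - (along X (along Z B) z * along Y A z + along Z B z * along X (along Y A) z).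
Proof.
move=> sA sB Wz.
have dd (f : H -> R) (X' : H -> H) : smooth_on W f -> smooth_on W X' ->
    differentiable (along X' f) z.
  by move=> sf sX; have [] := diff_along frame_H oW 0 (sf 2) (sX 1) Wz.
by apply: diff_mul_sub; exact: dd.
Qed.

Let jacobi_cancel (a1 a2 a11 a12 a21 a22 b1 b2 b11 b12 b21 b22
    c1 c2 c11 c12 c21 c22 : R) : a21 = a12 -> b21 = b12 -> c21 = c12 ->
    ((c11 * b2 + c1 * b12) - (c12 * b1 + c2 * b11)) * a2
  - ((c21 * b2 + c1 * b22) - (c22 * b1 + c2 * b21)) * a1
  + (((a11 * c2 + a1 * c12) - (a12 * c1 + a2 * c11)) * b2
  - ((a21 * c2 + a1 * c22) - (a22 * c1 + a2 * c21)) * b1)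
  + (((b11 * a2 + b1 * a12) - (b12 * a1 + b2 * a11)) * c2
  - ((b21 * a2 + b1 * a22) - (b22 * a1 + b2 * a21)) * c1) = 0.
Proof. by move=> -> -> ->; ring. Qed.

(** In the cyclic sum every second derivative occurs twice with opposite signs
    once the mixed ones are identified by [along_commute]. *)
Lemma poisson_on_wedge : poisson_on W (fun z => wedge (Y z) (Z z)).
Proof.
split=> [z _|A B C sA sB sC z Wz]; first exact: skew_wedge.
have P A' B' C' : smooth_on W B' -> smooth_on W C' ->
    poisson_bracket (fun z => wedge (Y z) (Z z)) A'
      (poisson_bracket (fun z => wedge (Y z) (Z z)) B' C') z =
    ((along Y (along Y C') z * along Z B' z + along Y C' z * along Y (along Z B') z)
     - (along Y (along Z C') z * along Y B' z + along Z C' z * along Y (along Y B') z))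
      * along Z A' z
    - ((along Z (along Y C') z * along Z B' z + along Y C' z * along Z (along Z B') z)
     - (along Z (along Z C') z * along Y B' z + along Z C' z * along Z (along Y B') z))
      * along Y A' z.
  move=> sB' sC'; rewrite (poisson_bracket_wedge _ _ B') poisson_bracket_wedge.
  by congr (_ * _ - _ * _); exact: along_bracket.
rewrite (P A B C sB sC) (P B C A sC sA) (P C A B sA sB).
by apply: jacobi_cancel; exact: along_commute.
Qed.

End Jacobi.

(** * Fields with prescribed values on functionals *)

Lemma open_preimage_on {R : realType} (V W : normedModType R) (A : set V) (B : set W)
    (f : V -> W) : open A -> open B -> (forall x, A x -> {for x, continuous f}) ->
  open [set x | A x /\ B (f x)].
Proof.
move=> oA oB cf; rewrite openE => x [Ax Bfx].
rewrite /interior; near=> y; split; first by near: y; exact: open_nbhs_nbhs.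
by near: y; apply: (cf x Ax); exact: open_nbhs_nbhs.
Unshelve. all: by end_near. Qed.

Section DualField.
Context {R : realType} {H : innerProductType R}.
Variables (z0 : H) (U : set H) (n : nat) (f : 'I_n -> H -> R) (i0 : 'I_n).
Hypotheses (oU : open U) (Uz0 : U z0) (sf : forall i, smooth_on U (f i)).
Hypothesis indep : forall x : 'I_n -> R,
  (forall v, \sum_i x i * 'd (f i) z0 v = 0) -> forall i, x i = 0.

Let g j := grad (f j) z0.
Let M z : 'M[R]_n := \matrix_(i, j) 'd (f i) z (g j).

(** A Gram matrix of independent vectors: an element of its kernel gives a
    combination of the gradients that is orthogonal to itself. *)
Let det_M0 : \det (M z0) != 0.
Proof.
have : row_free (M z0).
  apply: inj_row_free => v vM.
  pose w := \sum_i v 0 i *: g i.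
  have innerw u : inner w u = \sum_i v 0 i * 'd (f i) z0 u.
    rewrite inner_sym /w linear_sum; apply: eq_bigr => i _.
    by rewrite linearZ /= inner_sym gradE.
  have w0 : w = 0.
    apply/eqP; rewrite -normr_eq0 -sqrf_eq0 -inner_norm {2}/w linear_sum.
    apply/eqP; apply: big1 => j _; rewrite linearZ /= innerw.
    have /rowP/(_ j) := vM; rewrite !mxE => E.
    rewrite -[RHS](mulr0 (v 0 j)) -[X in _ = _ * X]E; congr (_ * _).
    by apply: eq_bigr => i _; rewrite mxE.
  apply/rowP => i; rewrite [RHS]mxE; apply: (indep (x := fun i => v 0 i)) => u.
  by rewrite -innerw w0 inner_sym linear0.
by rewrite row_free_unit unitmxE unitfE.
Qed.

Let M_smooth k i j : is_Ck k U (fun z => M z i j).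
Proof.
apply: is_Ck_ext oU _ (is_Ck_diff (g j) oU (sf i k.+1)) => z _.
by rewrite mxE.
Qed.

(** The equations for the coefficients of [Y] on the fixed vectors [g j] form a
    linear system with matrix [M z], solved by Cramer's rule; the adjugate keeps
    the solution visibly smooth. *)
Lemma dual_field : exists (W : set H) (Y : H -> H),
  [/\ open W, W z0, W `<=` U & smooth_on W Y] /\
  forall z, W z -> forall i, 'd (f i) z (Y z) = (i == i0)%:R.
Proof.
have det_smooth k : is_Ck k U (fun z => \det (M z)).
  by apply: is_Ck_det => // i j; exact: M_smooth.
pose W := [set z | U z /\ [set x : R | x != 0] (\det (M z))].
have oW : open W.
  apply: (@open_preimage_on _ _ R U [set x : R | x != 0] (fun z => \det (M z)) oU).
    exact: open_neq.
  by move=> x Ux; exact: is_Ck_continuous (det_smooth 0) Ux.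
have WU : W `<=` U by move=> z [].
exists W, (fun z => \sum_j ((\det (M z))^-1 * (\adj (M z)) j i0) *: g j); split.
  split => // k; apply: (is_Ck_sum xpredT oW) => j.
  apply: (is_Ck_scale oW); last exact: is_Ck_cst.
  apply: (is_Ck_mul oW).
    apply: (is_Ck_inv oW); first by move=> z [].
    exact: is_Ck_sub WU (det_smooth k).
  have cdet : is_Ck k W (fun z => \det (row' i0 (col' j (M z)))).
    apply: (is_Ck_det oW) => p q; apply: is_Ck_ext oW _ (is_Ck_sub WU (M_smooth k (lift i0 p) (lift j q))) => z _.
    by rewrite !mxE.
  apply: is_Ck_ext oW _ (is_Ck_mul oW (is_Ck_cst k W ((-1) ^+ (i0 + j) : R)) cdet) => z _.
  by rewrite mxE /cofactor.
move=> z [Uz dz] i; rewrite linear_sum /=.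
have /matrixP/(_ i i0) := mul_mx_adj (M z); rewrite !mxE => E.
have := congr1 ( *%R (\det (M z))^-1) E; rewrite /= mulrnAr mulVf// => <-.
rewrite mulr_sumr; apply: eq_bigr => j _; rewrite linearZ !mxE /=.
by rewrite -[LHS]/(_ * _ * _) -mulrA; congr (_ * _); rewrite mulrC.
Qed.

End DualField.

Lemma free_cons_codom {R : realType} {V : vectType R} (m : nat) (l0 : V)
    (l : 'I_m -> V) (x : 'I_m.+1 -> R) : free (l0 :: [seq l a | a : 'I_m]) ->
  \sum_i x i *: (if unlift ord0 i is Some a then l a else l0) = 0 -> forall i, x i = 0.
Proof.
set X := _ :: _ => fX E.
have sX : size X == m.+1 by rewrite /= size_image card_ord.
have /freeP := (fX : free (Tuple sX)); apply => /=.
rewrite -[RHS]E; apply: eq_bigr => i _; congr (_ *: _).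
case: unliftP => [a|] -> //=.
by rewrite add0n (nth_map a) ?size_enum_ord// nth_ord_enum.
Qed.

(** * Invariance under the flow *)

Section LocalFlowTheory.
Context {R : realType} {V : normedModType R}.
Variables (U N : set V) (T : R) (Z : V -> V) (phi : R -> V -> V) (psi : R -> V -> V -> V).
Hypotheses (sZ : smooth_on U Z) (lf : local_flow U N T Z phi psi).

(** The joint differential in time and space, from its two partial ones. *)
Lemma local_flow_diff (t : R) (x : V) (a : R) (v : V) : N x -> `|t| < T ->
  'd (fun p => phi p.1 p.2) (t, x) (a, v) = a *: Z (phi t x) + psi t x v.
Proof.
move=> Nx tT; have [dF _] := lf_smooth lf 1; have {}dF := dF (t, x) (conj tT Nx).
have -> : (a, v) = a *: (1, 0) + (0, v).
  by rewrite -[RHS]/(a *: 1 + 0, a *: 0 + v) scaler0 add0r addr0 -[_ *: _]/(_ * _) mulr1.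
rewrite linearP -!(deriveE _ dF).
have [_ ->] := @is_derive_fst _ _ _ (fun p => phi p.1 p.2) t x _ (lf_der lf Nx tT).
by have [_ ->] := @is_derive_snd _ _ _ (fun p => phi p.1 p.2) t x v _ (lf_diff lf v Nx tT).
Qed.

Lemma local_flow_tangentP (t : R) (x : V) (a : R) (u v : V) : N x -> `|t| < T ->
  psi t x (a *: u + v) = a *: psi t x u + psi t x v.
Proof.
move=> Nx tT; have E w := local_flow_diff 0 w Nx tT.
have {}E w : psi t x w = 'd (fun p => phi p.1 p.2) (t, x) (0, w).
  by rewrite E scale0r add0r.
rewrite !E -linearP; congr ('d _ _ _).
by rewrite -[RHS]/(a *: 0 + 0, a *: u + v) scaler0 addr0.
Qed.

(** The flow preserves its own field, because [Z] along an orbit solves the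
    variational equation. *)
Lemma local_flow_field (t : R) (x : V) : N x -> `|t| < T ->
  psi t x (Z x) = Z (phi t x).
Proof.
move=> Nx tT; apply/esym.
apply: (@lf_tangent_unique _ _ _ _ _ _ _ _ lf x (Z x) (fun s => Z (phi s x)) t Nx tT).
  by rewrite (lf_0 lf Nx).
move=> s st; have sT := le_lt_trans st tT.
apply: is_derive_chain; first exact: (lf_der lf Nx sT).
have [dZ _] := sZ 1; apply: dZ; exact: (lf_in lf Nx sT).
Qed.

Lemma first_integral_flow (f : V -> R) (t : R) (x : V) :
  (forall y, U y -> differentiable f y) -> (forall y, U y -> 'd f y (Z y) = 0) ->
  N x -> `|t| < T -> f (phi t x) = f x.
Proof.
move=> df fZ Nx tT.
have h1 (s : R) : `|s| <= `|t| -> is_derive s 1 (fun s => f (phi s x)) 0.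
  move=> st; have sT := le_lt_trans st tT.
  have Uy := lf_in lf Nx sT.
  rewrite -(fZ _ Uy); apply: is_derive_chain (lf_der lf Nx sT) _.
  exact: df.
have h2 (s : R) : `|s| <= `|t| -> `|(0 : R)| <= 0 by rewrite normr0.
have := growth_cst frame_R h1 h2; rewrite mulr0 mul0r (lf_0 lf Nx) => H.
by apply/eqP; rewrite -subr_eq0 -normr_le0.
Qed.

(** Differentiation, in the starting point, of the conservation law stated by
    [first_integral_flow]. *)
Lemma first_integral_tangent (f : V -> R) (t : R) (x v : V) : 
  (forall y, U y -> differentiable f y) -> (forall y, U y -> 'd f y (Z y) = 0) ->
  N x -> U x -> `|t| < T -> 'd f (phi t x) (psi t x v) = 'd f x v.
Proof.
move=> df fZ Nx Ux tT; have Uy := lf_in lf Nx tT.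
have dfx := df x Ux.
rewrite -(deriveE _ dfx).
have [_ <-] : is_derive x v (f \o phi t) ('d f (phi t x) (psi t x v)).
  have := lf_diff lf v Nx tT.
  rewrite -{1}[x](addr0 x) -[X in x + X](scale0r v) => /is_derive_line D.
  have := is_derive_chain D.
  rewrite scale0r addr0 => /(_ _ f (df _ Uy)) D'.
  rewrite -[X in is_derive X](addr0 x) -[X in is_derive (x + X)](scale0r v).
  exact: (is_derive_line (f \o phi t) x v _ 0).2.
apply: (derive_ext _ (lf_open lf) _ Nx) => y Ny.
exact: first_integral_flow.
Qed.

End LocalFlowTheory.

(** * A function growing at unit speed along the field *)

Section TimeFunction.
Context {R : realType} {H : innerProductType R}.
Variables (z0 : H) (U : set H) (Z : H -> H).
Hypotheses (oU : open U) (Uz0 : U z0) (sZ : smooth_on U Z) (Zz0 : Z z0 != 0).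

(** On H * R consider the field (Z / h, 1 / h) with [h z = inner (Z z0) (Z z)]:
    its first component raises the linear function of [z - z0] given by
    [inner (Z z0)] at unit speed, and its second component counts the time of
    [Z]. Starting from (z, 0) and following it for minus the value of this
    linear function at [z] leads back to the hyperplane, and the second
    component there is minus the time that [Z] needs from the hyperplane
    to [z]. *)
Lemma time_function : exists (W : set H) (s : H -> R),
  [/\ open W, W z0, W `<=` U & smooth_on W s] /\ s z0 = 0 /\
  forall z, W z -> is_derive z (Z z) s 1.
Proof.
pose h z := inner (Z z0) (Z z).
have ch k : is_Ck k U h.
  exact: (@is_Ck_lin _ _ _ _ k U (inner (Z z0) : {linear H -> R^o}) Z oU
    (@inner_continuous _ _ (Z z0)) (sZ k)).
pose U1 := [set z | U z /\ [set x : R | 0 < x] (h z)].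
have oU1 : open U1.
  apply: (@open_preimage_on _ _ R U [set x : R | 0 < x] h oU); first exact: open_gt.
  by move=> x Ux; exact: is_Ck_continuous (ch 0) Ux.
have U1z0 : U1 z0 by split => //=; rewrite /h inner_norm exprn_gt0// normr_gt0.
have U1U : U1 `<=` U by move=> z [].
pose UU := [set p : H * R | U1 p.1].
have oUU : open UU by exact: open_fst.
pose Zh (p : H * R) : H * R := ((h p.1)^-1 *: Z p.1, (h p.1)^-1).
have sZh : smooth_on UU Zh.
  move=> k.
  have cf : is_Ck k UU (fst : H * R -> H) by exact: (is_Ck_linear k oUU fst_continuous).
  have ci : is_Ck k UU (fun p => (h p.1)^-1).
    apply: (is_Ck_inv oUU); first by move=> p [_ /=]; rewrite lt0r => /andP[].
    exact: (is_Ck_comp frame_H oUU oU1 _ (is_Ck_sub U1U (ch k)) cf).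
  apply: (is_Ck_pair oUU _ ci); apply: (is_Ck_scale oUU ci).
  exact: (is_Ck_comp frame_H oUU oU1 _ (is_Ck_sub U1U (sZ k)) cf).
have [N [T [phi [psi [Nz0 lf]]]]] :=
  @local_flow_exists _ _ (frame_prod frame_H frame_R) UU Zh (z0, 0) oUU U1z0 sZh.
pose F (p : R * (H * R)) := phi p.1 p.2.
pose j (z : H) : R * (H * R) := (- inner (Z z0) (z - z0), (z, 0)).
have oD := @open_flow_dom _ _ T _ (lf_open lf).
have cj k : is_Ck k setT j.
  have oT : open [set: H] := openT.
  apply: (is_Ck_pair oT); last first.
    by apply: (is_Ck_pair oT); [exact: is_Ck_id|exact: is_Ck_cst].
  apply: (is_Ck_opp oT).
  apply: (@is_Ck_lin _ _ _ _ k setT (inner (Z z0) : {linear H -> R^o}) (fun z => z - z0) oT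
    (@inner_continuous _ _ (Z z0))).
  by apply: (is_Ck_add oT); [exact: is_Ck_id|exact: is_Ck_cst].
pose W := [set z | U1 z /\ flow_dom T N (j z)].
have oW : open W.
  apply: open_preimage_on => // z _; exact: (is_Ck_continuous (cj 0)).
have Wz0 : W z0.
  by split => //; split => //=; rewrite subrr linear0 oppr0 normr0; exact: (lf_T lf).
have WU : W `<=` U by move=> z [/U1U].
exists W, (fun z => - (F (j z)).2); split.
  split=> // k; apply: (is_Ck_opp oW).
  apply: (@is_Ck_lin _ _ _ _ k W (snd : {linear (H * R)%type -> R}) (F \o j) oW snd_continuous).
  apply: (is_Ck_comp (frame_prod frame_R (frame_prod frame_H frame_R)) oW oD _ (lf_smooth lf k)).
    by move=> z [].
  exact: is_Ck_sub (cj k).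
split.
  by rewrite /F /j /= subrr linear0 oppr0 (lf_0 lf)//= oppr0.
move=> z [U1z Dz]; have [tT Nx] := Dz; rewrite /= in tT Nx.
have hz : 0 < h z by case: U1z.
have dF : differentiable F (j z) by have [d _] := lf_smooth lf 1; exact: d.
have dj : differentiable j z by have [d _] := cj 1; exact: d.
have Ej : 'd j z (Z z) = (- h z, (Z z, 0)).
  rewrite -(deriveE _ dj).
  suff [_ ->] : is_derive z (Z z) j (- h z, (Z z, 0)) by [].
  apply/is_deriveP => e e0; exists 1 => // q _.
  suff -> : j (z + q *: Z z) = j z + q *: (- h z, (Z z, 0)).
    by rewrite [j z + _]addrC addrK subrr normr0 mulr_ge0// ltW.
  rewrite -[RHS]/(- inner (Z z0) (z - z0) + q * - h z, (z + q *: Z z, 0 + q *: 0)).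
  congr (_, (_, _)); last by rewrite scaler0 addr0.
  by rewrite addrAC linearD linearZ /= opprD mulrN.
set t := - inner (Z z0) (z - z0) in tT *.
set x := (z, 0) in Nx *.
(* The starting point moves along [Z] in the first component only. This is
   [h z] times the auxiliary field, corrected by a translation of the clock,
   which the flow preserves. *)
have Zhx : (Z z, 0) = h z *: Zh x + (0, - 1).
  rewrite -[RHS]/(h z *: ((h z)^-1 *: Z z) + 0, h z *: (h z)^-1 - 1).
  by rewrite addr0 scalerA divff ?gt_eqF// scale1r -[_ *: _]/(_ * _) divff ?gt_eqF// subrr.
have psi1 : psi t x (0, - 1) = (0, - 1).
  apply/esym; apply: (@lf_tangent_unique _ _ _ _ _ _ _ _ lf x (0, -1) (fun=> (0, -1)) t Nx tT) => //.
  move=> s st; have sT := le_lt_trans st tT.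
  have [dZh _] := sZh 1; have dZ := dZh _ (lf_in lf Nx sT).
  rewrite -(deriveE _ dZ).
  suff [_ ->] : is_derive (phi s x) (0, -1) Zh 0 by exact: is_derive_cst.
  apply/is_deriveP => e e0; exists 1 => // q _.
  by rewrite /Zh /= scaler0 addr0 subrr scaler0 subr0 normr0 mulr_ge0// ltW.
have DG : is_derive z (Z z) (F \o j) (0, - 1).
  have := diff_is_derive (Z z) (differentiable_comp dj dF).
  rewrite (diff_comp dj dF) /= Ej (local_flow_diff lf _ _ Nx tT) Zhx.
  rewrite (local_flow_tangentP lf _ _ _ Nx tT) (local_flow_field sZh lf Nx tT).
  by rewrite psi1 scaleNr addKr.
have := is_derive_lin (l := (snd : {linear (H * R)%type -> R})) snd_continuous DG.
move=> D; have := is_deriveN D; rewrite /= opprK.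
by [].
Qed.

End TimeFunction.

(** * Transporting a field along the flow *)

Section SymmetryField.
Context {R : realType} {H : innerProductType R}.
Variables (z0 : H) (U : set H) (Z : H -> H) (n : nat) (f : 'I_n -> H -> R) (i0 : 'I_n).
Hypotheses (oU : open U) (Uz0 : U z0) (sZ : smooth_on U Z) (Zz0 : Z z0 != 0).
Hypothesis sf : forall i, smooth_on U (f i).
Hypothesis fZ : forall i z, U z -> 'd (f i) z (Z z) = 0.
Hypothesis indep : forall x : 'I_n -> R,
  (forall v, \sum_i x i * 'd (f i) z0 v = 0) -> forall i, x i = 0.

(** [Y] is the push-forward, for the time [s z], of a field [Y0] with the right
    values at the point [q z] of the orbit where the time function vanishes.
    Since [q] does not change along [Z], only the time argument of [psi]
    contributes to the derivative of [Y] along [Z], and the variational equation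
    turns it into the derivative of [Z] along [Y]. *)
Lemma symmetry_field : exists (W : set H) (Y : H -> H),
  [/\ open W, W z0, W `<=` U & smooth_on W Y] /\
  (forall z, W z -> lie_bracket Y Z z = 0) /\
  forall z, W z -> forall i, 'd (f i) z (Y z) = (i == i0)%:R.
Proof.
have [U0 [Y0 [[oU0 U0z0 U0U sY0] HY0]]] := dual_field i0 oU Uz0 sf indep.
have sZ0 : smooth_on U0 Z by move=> k; exact: is_Ck_sub U0U (sZ k).
have [Us [s [[oUs Usz0 UsU0 ss] [s0 Hs]]]] := time_function oU0 U0z0 sZ0 Zz0.
have [N [T [phi [psi [Nz0 lf]]]]] := local_flow_exists frame_H oU0 U0z0 sZ0.
have T0 := lf_T lf.
have oD := @open_flow_dom _ _ T _ (lf_open lf).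
(* Half of the lifetime, so that going to [q z] and back is covered by the
   group law. *)
pose T2 := T / 2.
pose A := [set z | (Us `&` N) z /\ [set t : R | `|t| < T2] (s z)].
have oA : open A.
  apply: (@open_preimage_on _ _ R); [exact: openI (lf_open lf)|exact: open_norm_lt|].
  by move=> z [Uz _]; exact: is_Ck_continuous (ss 0) Uz.
have T2T (t : R) : `|t| < T2 -> `|t| < T by rewrite /T2 => t2; have := normr_ge0 t; lra.
pose F (p : R * H) := phi p.1 p.2.
pose q z := phi (- s z) z.
have cs k : is_Ck k A s by apply: is_Ck_sub (ss k) => z [[]].
have cq k : is_Ck k A q.
  apply: (is_Ck_comp (frame_prod frame_R frame_H) (f := fun z => (- s z, z)) oA oD _ (lf_smooth lf k)).
    by move=> z [[_ Nz] sz]; split => //=; rewrite normrN; exact: T2T.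
  by apply: (is_Ck_pair oA); [exact: is_Ck_opp|exact: is_Ck_id].
pose W := [set z | A z /\ (N `&` U0) (q z)].
have oW : open W.
  apply: open_preimage_on => //; first exact: openI (lf_open lf) oU0.
  by move=> z Az; exact: is_Ck_continuous (cq 0) Az.
have qz0 : q z0 = z0 by rewrite /q s0 oppr0 (lf_0 lf).
have Wz0 : W z0.
  split; last by rewrite /= qz0.
  by split => //=; rewrite s0 normr0 divr_gt0.
have WA : W `<=` A by move=> z [].
have WU : W `<=` U by move=> z [[[/UsU0/U0U]]].
pose Y z := psi (s z) (q z) (Y0 (q z)).
pose j z : R * (H * H) := (s z, (q z, Y0 (q z))).
pose D2 := flow_dom T [set p : H * H | N p.1].
have oD2 : open D2 by apply: open_flow_dom; exact: open_fst (lf_open lf).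
pose Psi (p : R * (H * H)) := psi p.1 p.2.1 p.2.2.
have jD z : W z -> D2 (j z).
  by move=> [[_ sz] [Nq _]]; split => //=; exact: T2T.
have cj k : is_Ck k W j.
  apply: (is_Ck_pair oW); first exact: is_Ck_sub WA (cs k).
  apply: (is_Ck_pair oW); first exact: is_Ck_sub WA (cq k).
  apply: (is_Ck_comp frame_H oW oU0 _ (sY0 k)); last exact: is_Ck_sub WA (cq k).
  by move=> z [_ []].
(* Pushing forward from [q z] for the time [s z] returns to [z]. *)
have back z : W z -> phi (s z) (q z) = z.
  move=> [[[_ Nz] sz] [Nq _]]; rewrite (lf_group lf Nz Nq) ?subrr ?(lf_0 lf)//.
  by rewrite normrN; rewrite /= /T2 in sz; lra.
exists W, Y; split.
  split => // k; apply: (is_Ck_comp (frame_prod frame_R (frame_prod frame_H frame_H)) oW oD2 _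
    (lf_tangent_smooth lf k) (cj k)); exact: jD.
split; last first.
  move=> z Wz i; have [[[_ Nz] sz] [Nq Uq]] := Wz.
  have df y : U0 y -> differentiable (f i) y.
    by move=> /U0U Uy; have [d _] := sf i 1; exact: d.
  have E := first_integral_tangent lf (Y0 (q z)) df (fun y Uy => fZ i (U0U _ Uy)) Nq Uq (T2T _ sz).
  rewrite (back z Wz) in E; apply: (etrans E); exact: HY0.
move=> z Wz; have [[[Usz Nz] sz] [Nq Uq]] := Wz.
have sT := T2T _ sz.
have sTN : `|- s z| < T by rewrite normrN.
have dsm : differentiable s z by have [d _] := ss 1; exact: d.
have dq : differentiable q z by have [d _] := cq 1; apply: d; exact: WA.
have dY0 : differentiable Y0 (q z) by have [d _] := sY0 1; exact: d.
have dj : differentiable j z by have [d _] := cj 1; exact: d.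
have ds : 'd s z (Z z) = 1 by rewrite -(deriveE _ dsm); have [_ ->] := Hs z Usz.
have qZ : 'd q z (Z z) = 0.
  have dF : differentiable F (- s z, z) by have [d _] := lf_smooth lf 1; exact: d.
  have dms : differentiable (fun z => - s z) z by exact: differentiableN.
  have did : differentiable (id : H -> H) z by exact: ex_diff.
  have Ep : 'd (fun z => (- s z, z)) z (Z z) = (-1, Z z).
    rewrite (diff_pair dms did) /= -(deriveE _ dms) -(deriveE _ did) derive_id.
    by have [_ ->] := is_deriveN (Hs z Usz).
  rewrite -[q]/(F \o (fun z => (- s z, z))).
  rewrite (diff_comp (differentiable_pair dms did) dF) /= Ep.
  rewrite (local_flow_diff lf _ _ Nz sTN) (local_flow_field sZ0 lf Nz sTN).
  by rewrite scaleN1r addNr.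
have dYq : differentiable (Y0 \o q) z by exact: differentiable_comp.
have jZ : 'd j z (Z z) = (1, (0, 0)).
  rewrite (diff_pair dsm (differentiable_pair dq dYq)) /= ds (diff_pair dq dYq) /= qZ.
  by rewrite (diff_comp dq dY0) /= qZ linear0.
have dPsi : differentiable Psi (j z) by have [d _] := lf_tangent_smooth lf 1; apply: d; exact: jD.
have YZ : 'd Y z (Z z) = 'd Z z (Y z).
  rewrite -[Y]/(Psi \o j) (diff_comp dj dPsi) /= jZ -(deriveE _ dPsi).
  have D := lf_tangent_der lf (Y0 (q z)) Nq sT; rewrite (back z Wz) in D.
  by have [_ ->] := @is_derive_fst _ _ _ Psi (s z) (q z, Y0 (q z)) _ D.
by rewrite /lie_bracket YZ subrr.
Qed.

End SymmetryField.

Theorem proposition3p8 (R : realType) (H : innerProductType R) (z0 : H)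
    (U : set H) (m : nat) (Z : H -> H) (F : H -> R) (C : 'I_m -> H -> R)
    (oU : open U) (Uz0 : U z0)
    (smoothZ : smooth_on U Z) (smoothF : smooth_on U F)
    (smoothC : forall a, smooth_on U (C a))
    (Zz0 : Z z0 != 0)
    (dFZ : \forall z \near z0, 'd F z (Z z) = 0)
    (dCZ : forall a, \forall z \near z0, 'd (C a) z (Z z) = 0)
    (indep : free ((linfun ('d F z0) : 'Hom(H, R^o))
                   :: [seq linfun ('d (C a) z0) | a : 'I_m])) :
  exists (W : set H) (Y : H -> H),
    [/\ open W, W z0, W `<=` U & smooth_on W Y] /\
    [/\ forall z, W z -> lie_bracket Y Z z = 0,
        forall z, W z -> 'd F z (Y z) = 1 &
        forall a z, W z -> 'd (C a) z (Y z) = 0] /\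
    let L2 := fun z => wedge (Y z) (Z z) in
    [/\ poisson_on W L2,
        forall z, W z -> L2 z (grad F z) = Z z &
        forall a z, W z -> L2 z (grad (C a) z) = 0].
Proof.
pose f (i : 'I_m.+1) := if unlift ord0 i is Some a then C a else F.
have f0 : f ord0 = F by rewrite /f unlift_none.
have fC a : f (lift ord0 a) = C a by rewrite /f liftK.
have nearU : \forall z \near z0, U z /\ forall i, 'd (f i) z (Z z) = 0.
  apply: filterI; first exact: open_nbhs_nbhs.
  apply: filter_forall => i; rewrite /f.
  by case: (unlift ord0 i) => [a|]; [exact: dCZ|exact: dFZ].
pose U1 := interior [set z | U z /\ forall i, 'd (f i) z (Z z) = 0].
have oU1 : open U1 by exact: open_interior.
have U1P z : U1 z -> U z /\ forall i, 'd (f i) z (Z z) = 0.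
  exact: interior_subset.
have U1U : U1 `<=` U by move=> z /U1P[].
have sf i : smooth_on U1 (f i).
  rewrite /f => k; apply: is_Ck_sub U1U _.
  by case: (unlift ord0 i) => [a|]; [exact: smoothC|exact: smoothF].
have sZ1 : smooth_on U1 Z by move=> k; exact: is_Ck_sub U1U (smoothZ k).
have indep1 (x : 'I_m.+1 -> R) :
    (forall v, \sum_i x i * 'd (f i) z0 v = 0) -> forall i, x i = 0.
  move=> Hx; apply: (free_cons_codom indep); apply/lfunP => v.
  rewrite sum_lfunE zero_lfunE -[RHS](Hx v); apply: eq_bigr => i _.
  by rewrite scale_lfunE /f; case: (unlift ord0 i) => [a|]; rewrite lfunE.
have [W [Y [[oW Wz0 WU1 sY] [YZ Hf]]]] :=
  symmetry_field ord0 oU1 nearU sZ1 Zz0 sf (fun i z Uz => (U1P z Uz).2 i) indep1.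
have FY z : W z -> 'd F z (Y z) = 1.
  by move=> Wz; rewrite -f0 (Hf z Wz ord0) eqxx.
have CY a z : W z -> 'd (C a) z (Y z) = 0.
  by move=> Wz; rewrite -fC (Hf z Wz (lift ord0 a)).
have FZ z : W z -> 'd F z (Z z) = 0 by move=> /WU1/U1P[_ /(_ ord0)]; rewrite f0.
have CZ a z : W z -> 'd (C a) z (Z z) = 0.
  by move=> /WU1/U1P[_ /(_ (lift ord0 a))]; rewrite fC.
exists W, Y; split; first by split => // z /WU1/U1U.
split=> //=; split.
- apply: poisson_on_wedge => // k; exact: is_Ck_sub WU1 (sZ1 k).
- move=> z Wz; rewrite /wedge ![inner _ (grad _ _)]inner_sym !gradE FY// FZ//.
  by rewrite scale1r scale0r subr0.
- move=> a z Wz; rewrite /wedge ![inner _ (grad _ _)]inner_sym !gradE CY// CZ//.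
  by rewrite !scale0r subr0.
Qed.
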